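(* Let $(M, F=\alpha^2/\beta)$ be a Kropina space with navigation data $(h,W)$. Then $(M,F)$ is a weakly-Berwald space if and only if it is a strong Kropina space, i.e. if and only if $W$ is a (unit) Killing vector field of the Riemannian space $(M,h)$.
   Context: Kropina space: $M$ is an $n$-dimensional differentiable manifold, $\alpha=\sqrt{a_{ij}(x)y^iy^j}$ is a Riemannian metric on $M$, $\beta=b_i(x)y^i$ is a nowhere vanishing 1-form, and $F=\alpha^2/\beta$ is regarded as a conic Finsler metric on the domain $\{(x,y)\in TM:\beta(x,y)>0\}$. Navigation data: with $b^2:=a^{ij}b_ib_j$ ($(a^{ij})$ the inverse matrix of $(a_{ij})$), let $\kappa=\kappa(x)$ be the function on $M$ defined by $e^{\kappa}b^2=4$, and put $h_{ij}:=e^{\kappa}a_{ij}$, $2W_i:=e^{\kappa}b_i$, $W^i:=h^{ij}W_j$, where $(h^{ij})$ is the inverse matrix of $(h_{ij})$. Then $h=\sqrt{h_{ij}y^iy^j}$ is a Riemannian metric and $W=W^i\,\partial/\partial x^i$ is a vector field of constant $h$-length $1$; $(h,W)$ is called the navigation data of $F$. Strong Kropina space: a Kropina space for which $W$ is a unit Killing vector field of $(M,h)$. Let $G^i=\frac14 g^{il}\left(\frac{\partial^2F^2}{\partial x^k\partial y^l}y^k-\frac{\partial F^2}{\partial x^l}\right)$, $g_{ij}=\frac12\frac{\partial^2F^2}{\partial y^i\partial y^j}$, be the coefficients of the geodesic spray of $F$, and put ${G^i}_j:=\partial G^i/\partial y^j$, ${{G_j}^i}_k:=\partial {G^i}_j/\partial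 y^k$, ${{G_j}^i}_{kl}:=\partial {{G_j}^i}_k/\partial y^l$. The space is weakly-Berwald if $G_{ij}:={{G_i}^r}_{jr}=0$ (sum over $r$) on the whole domain of $F$. *)

(* Defs.v *)
From HB Require Import structures.
From mathcomp Require Import all_boot all_order all_algebra.
From mathcomp Require Import all_classical all_reals all_analysis.
Set Implicit Arguments.
Unset Strict Implicit.
Unset Printing Implicit Defensive.
Import Order.TTheory GRing.Theory Num.Theory.
Import numFieldNormedType.Exports.
Local Open Scope classical_set_scope.
Local Open Scope ring_scope.

(* Points of R^n, tangent vectors and covectors in coordinates are all row
   vectors; the i-th component of v is v ord0 i. *)

Definition pd (R : realType) (n : nat) (i : 'I_n) (f : 'rV[R]_n -> R)
    (x : 'rV[R]_n) : R :=
  'D_(delta_mx ord0 i) f x.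

(* Meaningful for D open: functions are total, but only their germs at the
   points of D matter. *)
Fixpoint Ck (R : realType) (n k : nat) (D : set 'rV[R]_n)
    (f : 'rV[R]_n -> R) : Prop :=
  (forall x, D x -> {for x, continuous f}) /\
  (if k is k'.+1 then
     forall i : 'I_n,
       (forall x, D x -> derivable f x (delta_mx ord0 i)) /\ Ck k' D (pd i f)
   else True).

Definition smooth_on (R : realType) (n : nat) (D : set 'rV[R]_n)
    (f : 'rV[R]_n -> R) : Prop :=
  forall k, Ck k D f.

Record chart (R : realType) (n : nat) (T : topologicalType) := Chart {
  dom : set T ;
  fwd : T -> 'rV[R]_n ;
  bwd : 'rV[R]_n -> T ;
  dom_open : open dom ;
  cod_open : open (fwd @` dom) ;
  fwdK : forall p, dom p -> bwd (fwd p) = p ;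
  fwd_continuous : {within dom, continuous fwd} ;
  bwd_continuous : {within fwd @` dom, continuous bwd}
}.

Definition cod (R : realType) (n : nat) (T : topologicalType)
    (c : chart R n T) : set 'rV[R]_n := fwd c @` dom c.

Definition overlap (R : realType) (n : nat) (T : topologicalType)
    (c d : chart R n T) : set 'rV[R]_n := fwd c @` (dom c `&` dom d).

Definition transition (R : realType) (n : nat) (T : topologicalType)
    (c d : chart R n T) (k : 'I_n) (x : 'rV[R]_n) : R :=
  fwd d (bwd c x) ord0 k.

Record manifold (R : realType) (n : nat) := Manifold {
  carrier : topologicalType ;
  manifold_hausdorff : hausdorff_space carrier ;
  manifold_second_countable : @second_countable carrier ;
  chart_index : Type ;
  atlas : chart_index -> chart R n carrier ;
  atlas_cover : forall p : carrier, exists c, dom (atlas c) p ;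
  atlas_compatible : forall c d k,
    smooth_on (overlap (atlas c) (atlas d)) (transition (atlas c) (atlas d) k)
}.

Definition quad (R : realType) (n : nat) (A : 'M[R]_n) (y : 'rV[R]_n) : R :=
  \sum_i \sum_j A i j * y ord0 i * y ord0 j.

(* Tensor fields are families of components, one per chart, subject to the
   usual transformation law under changes of coordinates. *)

Record riemannian_metric (R : realType) (n : nat) (M : manifold R n) :=
    RiemannianMetric {
  metric_comp :> chart_index M -> 'rV[R]_n -> 'M[R]_n ;
  metric_smooth : forall c i j,
    smooth_on (cod (atlas c)) (fun x => metric_comp c x i j) ;
  metric_sym : forall c x, cod (atlas c) x ->
    (metric_comp c x)^T = metric_comp c x ;
  metric_posdef : forall c x, cod (atlas c) x ->
    forall y, y != 0 -> 0 < quad (metric_comp c x) y ;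
  metric_change : forall c d x, overlap (atlas c) (atlas d) x -> forall i j,
    metric_comp c x i j =
    \sum_k \sum_l metric_comp d (fwd (atlas d) (bwd (atlas c) x)) k l
      * pd i (transition (atlas c) (atlas d) k) x
      * pd j (transition (atlas c) (atlas d) l) x
}.

Record one_form (R : realType) (n : nat) (M : manifold R n) := OneForm {
  form_comp :> chart_index M -> 'rV[R]_n -> 'rV[R]_n ;
  form_smooth : forall c i,
    smooth_on (cod (atlas c)) (fun x => form_comp c x ord0 i) ;
  form_change : forall c d x, overlap (atlas c) (atlas d) x -> forall i,
    form_comp c x ord0 i =
    \sum_k form_comp d (fwd (atlas d) (bwd (atlas c) x)) ord0 k
      * pd i (transition (atlas c) (atlas d) k) x
}.

Definition nowhere_vanishing (R : realType) (n : nat) (M : manifold R n)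
    (b : one_form M) : Prop :=
  forall c x, cod (atlas c) x -> b c x != 0.

Definition alpha (R : realType) (n : nat) (a : 'rV[R]_n -> 'M[R]_n)
    (x y : 'rV[R]_n) : R := Num.sqrt (quad (a x) y).

Definition beta (R : realType) (n : nat) (b : 'rV[R]_n -> 'rV[R]_n)
    (x y : 'rV[R]_n) : R := \sum_i b x ord0 i * y ord0 i.

Definition kropina (R : realType) (n : nat) (a : 'rV[R]_n -> 'M[R]_n)
    (b : 'rV[R]_n -> 'rV[R]_n) (x y : 'rV[R]_n) : R :=
  alpha a x y ^+ 2 / beta b x y.

Definition fundamental_tensor (R : realType) (n : nat)
    (F : 'rV[R]_n -> 'rV[R]_n -> R) (x y : 'rV[R]_n) : 'M[R]_n :=
  \matrix_(i, j) (2^-1 * pd i (pd j (fun z => F x z ^+ 2)) y).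

Definition spray (R : realType) (n : nat) (F : 'rV[R]_n -> 'rV[R]_n -> R)
    (i : 'I_n) (x y : 'rV[R]_n) : R :=
  4^-1 * \sum_l invmx (fundamental_tensor F x y) i l *
    ((\sum_k pd k (fun u => pd l (fun z => F u z ^+ 2) y) x * y ord0 k)
     - pd l (fun u => F u y ^+ 2) x).

(* spray1 F i j is G^i_j, spray2 F j i k is G_j^i_k and spray3 F j i k l is
   G_j^i_kl. *)
Definition spray1 (R : realType) (n : nat) (F : 'rV[R]_n -> 'rV[R]_n -> R)
    (i j : 'I_n) (x y : 'rV[R]_n) : R := pd j (spray F i x) y.

Definition spray2 (R : realType) (n : nat) (F : 'rV[R]_n -> 'rV[R]_n -> R)
    (j i k : 'I_n) (x y : 'rV[R]_n) : R := pd k (spray1 F i j x) y.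

Definition spray3 (R : realType) (n : nat) (F : 'rV[R]_n -> 'rV[R]_n -> R)
    (j i k l : 'I_n) (x y : 'rV[R]_n) : R := pd l (spray2 F j i k x) y.

Definition spray_trace (R : realType) (n : nat)
    (F : 'rV[R]_n -> 'rV[R]_n -> R) (i j : 'I_n) (x y : 'rV[R]_n) : R :=
  \sum_r spray3 F i r j r x y.

Definition weakly_berwald (R : realType) (n : nat) (M : manifold R n)
    (a : riemannian_metric M) (b : one_form M) : Prop :=
  forall c x y, cod (atlas c) x -> 0 < beta (b c) x y ->
  forall i j, spray_trace (kropina (a c) (b c)) i j x y = 0.

Definition sqnorm (R : realType) (n : nat) (a : 'rV[R]_n -> 'M[R]_n)
    (b : 'rV[R]_n -> 'rV[R]_n) (x : 'rV[R]_n) : R := quad (invmx (a x)) (b x).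

(* The solution of expR kappa * b^2 = 4; see kappaE below. *)
Definition kappa (R : realType) (n : nat) (a : 'rV[R]_n -> 'M[R]_n)
    (b : 'rV[R]_n -> 'rV[R]_n) (x : 'rV[R]_n) : R := ln (4 / sqnorm a b x).

Definition nav_metric (R : realType) (n : nat) (a : 'rV[R]_n -> 'M[R]_n)
    (b : 'rV[R]_n -> 'rV[R]_n) (x : 'rV[R]_n) : 'M[R]_n :=
  expR (kappa a b x) *: a x.

Definition nav_covector (R : realType) (n : nat) (a : 'rV[R]_n -> 'M[R]_n)
    (b : 'rV[R]_n -> 'rV[R]_n) (x : 'rV[R]_n) : 'rV[R]_n :=
  (expR (kappa a b x) / 2) *: b x.

Definition nav_field (R : realType) (n : nat) (a : 'rV[R]_n -> 'M[R]_n)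
    (b : 'rV[R]_n -> 'rV[R]_n) (x : 'rV[R]_n) : 'rV[R]_n :=
  \row_i \sum_j invmx (nav_metric a b x) i j * nav_covector a b x ord0 j.

Definition lie_metric (R : realType) (n : nat) (h : 'rV[R]_n -> 'M[R]_n)
    (W : 'rV[R]_n -> 'rV[R]_n) (i j : 'I_n) (x : 'rV[R]_n) : R :=
  \sum_k (W x ord0 k * pd k (fun u => h u i j) x
          + h x k j * pd i (fun u => W u ord0 k) x
          + h x i k * pd j (fun u => W u ord0 k) x).

Definition nav_killing (R : realType) (n : nat) (M : manifold R n)
    (a : riemannian_metric M) (b : one_form M) : Prop :=
  forall c x, cod (atlas c) x -> forall i j,
  lie_metric (nav_metric (a c) (b c)) (nav_field (a c) (b c)) i j x = 0.

Definition nav_unit (R : realType) (n : nat) (M : manifold R n)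
    (a : riemannian_metric M) (b : one_form M) : Prop :=
  forall c x, cod (atlas c) x ->
  quad (nav_metric (a c) (b c) x) (nav_field (a c) (b c) x) = 1.

Definition strong_kropina (R : realType) (n : nat) (M : manifold R n)
    (a : riemannian_metric M) (b : one_form M) : Prop :=
  nav_unit a b /\ nav_killing a b.

Lemma quadE (R : realType) (n : nat) (A : 'M[R]_n) (y : 'rV[R]_n) :
  quad A y = (y *m A *m y^T) ord0 ord0.
Proof.
rewrite /quad mxE exchange_big; apply: eq_bigr => j _ /=.
rewrite !mxE mulr_suml; apply: eq_bigr => i _.
by rewrite (mulrC (A i j)).
Qed.

Lemma metric_unit (R : realType) (n : nat) (M : manifold R n)
    (a : riemannian_metric M) (c : chart_index M) (x : 'rV[R]_n) :
  cod (atlas c) x -> a c x \in unitmx.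
Proof.
move=> cx; rewrite -row_free_unit -kermx_eq0.
apply/negPn/negP => /matrix0Pn[i [j kij]].
have /(@metric_posdef _ _ _ a _ _ cx) : row i (kermx (a c x)) != 0.
  by apply/eqP => /rowP/(_ j); rewrite [LHS]mxE [RHS]mxE; apply/eqP.
by rewrite quadE -row_mul mulmx_ker row0 mul0mx mxE ltxx.
Qed.

Lemma sqnorm_gt0 (R : realType) (n : nat) (M : manifold R n)
    (a : riemannian_metric M) (b : one_form M) (c : chart_index M) (x : 'rV[R]_n) :
  nowhere_vanishing b -> cod (atlas c) x -> 0 < sqnorm (a c) (b c) x.
Proof.
move=> hb cx; have ua := metric_unit a cx.
have /(@metric_posdef _ _ _ a _ _ cx) : b c x *m invmx (a c x) != 0.
  apply/eqP => b0; move/eqP: (hb c x cx); apply.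
  by rewrite -(mulmxKV ua (b c x)) b0 mul0mx.
rewrite quadE mulmxKV// trmx_mul trmx_inv metric_sym// mulmxA.
by rewrite /sqnorm quadE.
Qed.

Lemma kappaE (R : realType) (n : nat) (M : manifold R n)
    (a : riemannian_metric M) (b : one_form M) (c : chart_index M) (x : 'rV[R]_n) :
  nowhere_vanishing b -> cod (atlas c) x ->
  expR (kappa (a c) (b c) x) * sqnorm (a c) (b c) x = 4.
Proof.
move=> hb cx; have s0 := sqnorm_gt0 a hb cx.
rewrite /kappa lnK ?posrE ?divr_gt0//.
by rewrite divfK// gt_eqF.
Qed.

(* Main.v *)
Require Import Defs.
From mathcomp Require Import all_boot all_order all_algebra.
From mathcomp Require Import all_classical all_reals all_analysis.
From mathcomp Require Import ring lra.

(** In a chart, [F = H / (2 w)] where [H = h(y, y)], [w(y) = h(W, y)] and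
    [h(W, W) = 1].  The equations of the geodesic spray can then be solved in
    closed form:
      [G^i = Gam^i_00 / 2 - F S^i_0 - (R_00 / (2 F) + S_0) (y^i - F W^i)],
    with [Gam] the Christoffel symbols of [h], [R_00] the symmetrized covariant
    derivative of [W] (half of the Lie derivative of [h] along [W]) contracted
    with [y] twice, [S] half of the exterior derivative of [w], and
    [S_0 = W^i S_i0].  The system is linear in [G], and its matrix is invertible
    since [g v = 0] forces [dF(v) = 0] and then [h(v, v) = 0]; so it suffices to
    substitute ([fiber_tensor_spray], [fiber_tensor_unit], [sprayE]).

    Everything quadratic in [y] contributes a linear function to the divergence
    of [G] along the fibre, and in the rest all the terms in [S] cancel, up to a
    linear one, because [S] is skew and [h(W, W) = 1]:
      [d G^r / d y^r = (linear in y) - (n + 1) R_00 / (2 F)]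
    ([spray_divergence]).  Partial derivatives commute on rational functions
    ([pd_comm]), so the mean Berwald tensor is [- (n + 1)] times the fibre
    Hessian of [phi = R_00 / (2 F) = R_00 w / H] ([spray_traceE]).

    If [W] is Killing then [phi = 0].  Conversely, suppose that the Hessian of
    [phi] vanishes on [w > 0].  For [v] orthogonal to [W], the line [W + s v]
    stays in the domain and [phi] is affine on it, while
      [phi (W + s v) = (2 s R(W, v) + s^2 R(v, v)) / (1 + s^2 h(v, v))],
    as [R(W, W) = 0] for a unit field.  Hence [R(v, v) = R(W, v) = 0], so the
    quadratic form [R] vanishes ([defect_hess_eq0]).

    Unit length of [W] is built into the navigation data, and the chart-wise
    derivatives exist because [h] and [W] are obtained from [a] and [b] by
    rational operations, inverse matrices included. *)

Set Implicit Arguments.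
Unset Strict Implicit.
Unset Printing Implicit Defensive.
Import Order.TTheory GRing.Theory Num.Theory.
Import numFieldNormedType.Exports.
Local Open Scope classical_set_scope.
Local Open Scope ring_scope.

(** * Scalar products of coordinate vectors *)

Section Dot.
Variables (R : realType) (n : nat).
Implicit Types (u v y : 'rV[R]_n) (A : 'M[R]_n) (c : R).

Definition dot u v : R := \sum_i u ord0 i * v ord0 i.

Lemma dotE u v : dot u v = (u *m v^T) ord0 ord0.
Proof. by rewrite mxE; apply: eq_bigr => i _; rewrite mxE. Qed.

Lemma dotC u v : dot u v = dot v u.
Proof. by apply: eq_bigr => i _; rewrite mulrC. Qed.

Lemma dotDl u1 u2 v : dot (u1 + u2) v = dot u1 v + dot u2 v.
Proof. by rewrite !dotE mulmxDl mxE. Qed.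

Lemma dotZl c u v : dot (c *: u) v = c * dot u v.
Proof. by rewrite !dotE -scalemxAl mxE. Qed.

Lemma dotNl u v : dot (- u) v = - dot u v.
Proof. by rewrite !dotE mulNmx mxE. Qed.

Lemma dotBl u1 u2 v : dot (u1 - u2) v = dot u1 v - dot u2 v.
Proof. by rewrite dotDl dotNl. Qed.

Lemma dotDr u v1 v2 : dot u (v1 + v2) = dot u v1 + dot u v2.
Proof. by rewrite dotC dotDl !(dotC u). Qed.

Lemma dotZr c u v : dot u (c *: v) = c * dot u v.
Proof. by rewrite dotC dotZl dotC. Qed.

Lemma dotBr u v1 v2 : dot u (v1 - v2) = dot u v1 - dot u v2.
Proof. by rewrite dotC dotBl !(dotC u). Qed.

Lemma dot0l v : dot 0 v = 0.
Proof. by rewrite dotE mul0mx mxE. Qed.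

Lemma dot0r u : dot u 0 = 0.
Proof. by rewrite dotC dot0l. Qed.

Lemma dot_deltar u i : dot u (delta_mx ord0 i) = u ord0 i.
Proof.
rewrite /dot (bigD1 i)//= mxE !eqxx mulr1 big1 ?addr0// => j ji.
by rewrite mxE (negbTE ji) andbF mulr0.
Qed.

Lemma dot_suml (I : finType) (f : I -> 'rV[R]_n) v :
  dot (\sum_k f k) v = \sum_k dot (f k) v.
Proof. by rewrite dotE mulmx_suml summxE; apply: eq_bigr => k _; rewrite dotE. Qed.

Lemma dot_mulmx u A v : dot (u *m A) v = dot u (v *m A^T).
Proof. by rewrite !dotE trmx_mul trmxK mulmxA. Qed.

Lemma mulmx_dot u A i : (u *m A) ord0 i = dot (row i A^T) u.
Proof. by rewrite mxE; apply: eq_bigr => j _; rewrite !mxE mulrC. Qed.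

Lemma quad_dot A y : quad A y = dot (y *m A) y.
Proof. by rewrite quadE dotE. Qed.

Lemma quadZ c A y : quad (c *: A) y = c * quad A y.
Proof. by rewrite !quad_dot -scalemxAr dotZl. Qed.

End Dot.

(** * Directional derivatives of real and matrix-valued functions *)

Section Derivatives.
Variables (R : realType) (V : normedModType R).
Implicit Types (x v : V) (f g : V -> R).

Lemma is_derive_bigsum (n : nat) (f : 'I_n -> V -> R) (df : 'I_n -> R) x v :
  (forall i, is_derive x v (f i) (df i)) ->
  is_derive x v (fun u => \sum_i f i u) (\sum_i df i).
Proof.
move=> fdf; rewrite (_ : (fun u => _) = \sum_i f i); first exact: is_derive_sum.
by apply/funext => u; rewrite fct_sumE.
Qed.

Lemma is_derive_mul f g x v (df dg : R) :
  is_derive x v f df -> is_derive x v g dg ->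
  is_derive x v (fun u => f u * g u) (df * g x + f x * dg).
Proof.
move=> fd gd; apply: (@is_derive_eq _ _ _ (f * g)).
by rewrite /GRing.scale/= addrC (mulrC df).
Qed.

Lemma is_derive_add f g x v (df dg : R) :
  is_derive x v f df -> is_derive x v g dg ->
  is_derive x v (fun u => f u + g u) (df + dg).
Proof. by move=> fd gd; apply: (@is_derive_eq _ _ _ (f + g)). Qed.

Lemma is_derive_sub f g x v (df dg : R) :
  is_derive x v f df -> is_derive x v g dg ->
  is_derive x v (fun u => f u - g u) (df - dg).
Proof. by move=> fd gd; apply: (@is_derive_eq _ _ _ (f - g)). Qed.

Lemma is_derive_inv f x v (df : R) : f x != 0 ->
  is_derive x v f df -> is_derive x v (fun u => (f u)^-1) (- df / f x ^+ 2).
Proof.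
move=> f0 fd; have fd' : derivable f x v by apply: ex_derive.
split; first exact: derivableV.
rewrite (_ : (fun u => _) = (fun y => (f y)^-1))// deriveV//.
by rewrite (@derive_val _ _ _ _ _ _ _ fd) /GRing.scale/= mulNr mulrC mulNr.
Qed.

Lemma is_derive_quot f g x v (df dg : R) :
  is_derive x v f df -> is_derive x v g dg -> g x != 0 ->
  is_derive x v (fun u => f u / g u) ((df - f x / g x * dg) / g x).
Proof.
move=> fd gd g0; apply: is_derive_eq (is_derive_mul fd (is_derive_inv g0 gd)) _.
by field.
Qed.

End Derivatives.

Section MatrixDerivatives.
Variables (R : realType) (U : normedModType R).
Implicit Types x v : U.

(** Entrywise rather than as a derivative in the space of matrices, since the
    partial derivatives of a tensor are only ever taken entry by entry. *)
Definition mx_derive x v (m p : nat) (f : U -> 'M[R]_(m, p)) (df : 'M[R]_(m, p)) :=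
  forall i j, is_derive x v (fun u => f u i j) (df i j).

Lemma mx_derive_cst x v m p (A : 'M[R]_(m, p)) : mx_derive x v (fun=> A) 0.
Proof. by move=> i j; rewrite mxE; exact: is_derive_cst. Qed.

Lemma mx_derive_mul x v m p q (f : U -> 'M[R]_(m, p)) (g : U -> 'M[R]_(p, q)) df dg :
  mx_derive x v f df -> mx_derive x v g dg ->
  mx_derive x v (fun u => f u *m g u) (df *m g x + f x *m dg).
Proof.
move=> fd gd i j; rewrite !mxE -big_split/=.
rewrite (_ : (fun u => _) = fun u => \sum_k f u i k * g u k j).
  by apply: is_derive_bigsum => k; exact: is_derive_mul.
by apply/funext => u; rewrite mxE.
Qed.

Lemma mx_derive_dot x v n (f g : U -> 'rV[R]_n) df dg :
  mx_derive x v f df -> mx_derive x v g dg ->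
  is_derive x v (fun u => dot (f u) (g u)) (dot df (g x) + dot (f x) dg).
Proof.
move=> fd gd; rewrite /dot -big_split/=.
by apply: is_derive_bigsum => k; exact: is_derive_mul.
Qed.

Lemma mx_derive_near x v m p (f g : U -> 'M[R]_(m, p)) df :
  (\near x, f x = g x) -> mx_derive x v f df -> mx_derive x v g df.
Proof.
move=> fg fd i j; apply: near_eq_is_derive (fd i j).
by apply: filterS fg => u ->.
Qed.

Lemma mx_derive_unique x v m p (f : U -> 'M[R]_(m, p)) df df' :
  mx_derive x v f df -> mx_derive x v f df' -> df = df'.
Proof.
move=> fd fd'; apply/matrixP => i j.
by rewrite -(@derive_val _ _ _ _ _ _ _ (fd i j)) (@derive_val _ _ _ _ _ _ _ (fd' i j)).
Qed.

End MatrixDerivatives.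

Lemma mx_derive_id (R : realType) (m p : nat) (A B : 'M[R]_(m, p)) :
  mx_derive A B id B.
Proof.
move=> i j; have /= d := @differentiable_coord R m p A i j.
split; first exact: diff_derivable.
apply: cvg_lim => //.
apply: (@cvg_trans _ (B i j @[t --> 0^'])); last exact: cvg_cst.
apply: near_eq_cvg; near=> t.
rewrite /= !mxE addrK scalerA mulVf ?scale1r//.
by near: t; exact: nbhs_dnbhs_neq.
Unshelve. all: by end_near. Qed.

Lemma mx_derive_quad (R : realType) (n : nat) (U : normedModType R) (x v : U)
    (f : U -> 'rV[R]_n) (A : U -> 'M[R]_n) df dA :
  mx_derive x v f df -> mx_derive x v A dA -> (A x)^T = A x ->
  is_derive x v (fun u => quad (A u) (f u))
    (quad dA (f x) + 2 * dot (f x *m A x) df).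
Proof.
move=> fd Ad As.
rewrite (_ : (fun u => _) = fun u => dot (f u *m A u) (f u)); last first.
  by apply/funext => u; rewrite quad_dot.
apply: is_derive_eq (mx_derive_dot (mx_derive_mul fd Ad) fd) _.
rewrite quad_dot dotDl (dot_mulmx df) As (dotC df).
ring.
Qed.

(** * Rational functions on an open set, and commuting partial derivatives *)

Section Rational.
Variables (R : realType) (n : nat) (D : set 'rV[R]_n).

(** Closure under partial derivatives ([rational_pd]) makes this a class on
    which the symmetry of second derivatives ([pd_comm]) can be iterated.  The
    constructor [rational_ext] is what allows it: [pd i f] is given by an
    algebraic formula on [D] only. *)
Inductive rational_on : ('rV[R]_n -> R) -> Prop :=
| rational_cst c : rational_on (fun=> c)
| rational_coord i : rational_on (fun y => y ord0 i)
| rational_add f g : rational_on f -> rational_on g ->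
    rational_on (fun y => f y + g y)
| rational_mul f g : rational_on f -> rational_on g ->
    rational_on (fun y => f y * g y)
| rational_inv f : (forall y, D y -> f y != 0) -> rational_on f ->
    rational_on (fun y => (f y)^-1)
| rational_ext f g : (forall y, D y -> f y = g y) ->
    rational_on f -> rational_on g.

Hypothesis oD : open D.

Lemma near_on (P : 'rV[R]_n -> Prop) y :
  D y -> (forall z, D z -> P z) -> \near y, P y.
Proof. by move=> Dy DP; apply: filterS (open_nbhs_nbhs (conj oD Dy)). Qed.

Lemma pd_ext (f g : 'rV[R]_n -> R) i y : (forall z, D z -> f z = g z) -> D y ->
  pd i f y = pd i g y.
Proof. by move=> fg Dy; apply: near_eq_derive; exact: near_on. Qed.

Lemma pd_val (f : 'rV[R]_n -> R) i y d :
  is_derive y (delta_mx ord0 i) f d -> pd i f y = d.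
Proof. by move=> fd; rewrite /pd (@derive_val _ _ _ _ _ _ _ fd). Qed.

Lemma rational_derivable f : rational_on f ->
  forall y v, D y -> derivable f y v.
Proof.
elim=> {f} [c|i|f g _ fd _ gd|f g _ fd _ gd|f f0 _ fd|f g fg _ fd] y v Dy.
- exact: derivable_cst.
- by have [] := mx_derive_id y v ord0 i.
- exact: derivableD (fd _ _ Dy) (gd _ _ Dy).
- exact: derivableM (fd _ _ Dy) (gd _ _ Dy).
- exact: derivableV (f0 _ Dy) (fd _ _ Dy).
- by apply: near_eq_derivable (fd _ v Dy); exact: near_on.
Qed.

Lemma rational_is_derive f i y : rational_on f -> D y ->
  is_derive y (delta_mx ord0 i) f (pd i f y).
Proof. by move=> rf Dy; apply: derivableP; exact: rational_derivable. Qed.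

Lemma pdD f g i y : rational_on f -> rational_on g -> D y ->
  pd i (fun z => f z + g z) y = pd i f y + pd i g y.
Proof.
move=> rf rg Dy; apply: pd_val.
by apply: is_derive_add; exact: rational_is_derive.
Qed.

Lemma pdM f g i y : rational_on f -> rational_on g -> D y ->
  pd i (fun z => f z * g z) y = pd i f y * g y + f y * pd i g y.
Proof.
move=> rf rg Dy; apply: pd_val.
by apply: is_derive_mul; exact: rational_is_derive.
Qed.

Lemma pdV f i y : (forall z, D z -> f z != 0) -> rational_on f -> D y ->
  pd i (fun z => (f z)^-1) y = - pd i f y * ((f y)^-1 * (f y)^-1).
Proof.
move=> f0 rf Dy; rewrite -invfM; apply: pd_val.
by apply: is_derive_inv; [exact: f0|exact: rational_is_derive].
Qed.

Lemma pdN f i y : rational_on f -> D y -> pd i (fun z => - f z) y = - pd i f y.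
Proof.
move=> rf Dy; apply: pd_val; apply: (@is_deriveN _ _ _ f).
exact: rational_is_derive.
Qed.

Lemma pd_cst (c : R) i (y : 'rV[R]_n) : pd i (fun=> c) y = 0.
Proof. by apply: pd_val; exact: is_derive_cst. Qed.

Lemma pd_coord i j (y : 'rV[R]_n) : pd i (fun z => z ord0 j) y = (j == i)%:R.
Proof. by apply: pd_val; apply: is_derive_eq (mx_derive_id _ _ _ _) _; rewrite mxE. Qed.

Lemma rational_opp f : rational_on f -> rational_on (fun y => - f y).
Proof.
move=> rf; apply: rational_ext (rational_mul (rational_cst (-1)) rf) => y _ /=.
by rewrite mulN1r.
Qed.

Lemma rational_sub f g : rational_on f -> rational_on g ->
  rational_on (fun y => f y - g y).
Proof. by move=> rf rg; exact: rational_add rf (rational_opp rg). Qed.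

Lemma rational_pd f i : rational_on f -> rational_on (pd i f).
Proof.
elim=> {f} [c|j|f g rf rf' rg rg'|f g rf rf' rg rg'|f f0 rf rf'|f g fg rf rf'].
- by apply: rational_ext (rational_cst 0) => y Dy; rewrite pd_cst.
- by apply: rational_ext (rational_cst (j == i)%:R) => y Dy; rewrite pd_coord.
- by apply: rational_ext (rational_add rf' rg') => y Dy; rewrite pdD.
- apply: rational_ext (rational_add (rational_mul rf' rg) (rational_mul rf rg')).
  by move=> y Dy; rewrite pdM.
- have rV := rational_inv f0 rf.
  apply: rational_ext (rational_mul (rational_opp rf') (rational_mul rV rV)).
  by move=> y Dy; rewrite pdV.
- by apply: rational_ext rf' => y Dy; apply: pd_ext.
Qed.

Lemma pd_pdM f g i j y : rational_on f -> rational_on g -> D y ->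
  pd j (pd i (fun z => f z * g z)) y = pd j (pd i f) y * g y
  + pd i f y * pd j g y + (pd j f y * pd i g y + f y * pd j (pd i g) y).
Proof.
move=> rf rg Dy.
have rf' := rational_pd i rf; have rg' := rational_pd i rg.
rewrite (pd_ext _ (fun z => pdM i rf rg (y:=z)) Dy) pdD ?pdM//.
  exact: rational_mul.
exact: rational_mul.
Qed.

(** By induction on the formula: the second-order Leibniz rules for [f * g] and
    [1 / f] are symmetric in the two directions as soon as the second derivatives
    of [f] and [g] are. *)
Lemma pd_comm f i j : rational_on f ->
  forall y, D y -> pd i (pd j f) y = pd j (pd i f) y.
Proof.
elim=> {f} [c|k|f g rf cf rg cg|f g rf cf rg cg|f f0 rf cf|f g fg rf cf] y Dy.
- by rewrite !(pd_ext _ (fun z _ => pd_cst c _ z) Dy) !pd_cst.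
- by rewrite !(pd_ext _ (fun z _ => pd_coord _ k z) Dy) !pd_cst.
- have rpd h m : rational_on h -> rational_on (pd m h) by exact: rational_pd.
  have E p q : pd p (pd q (fun z => f z + g z)) y
      = pd p (pd q f) y + pd p (pd q g) y.
    by rewrite (pd_ext _ (fun z => pdD q rf rg (y:=z)) Dy) pdD//; exact: rpd.
  by rewrite (E i j) (E j i) (cf _ Dy) (cg _ Dy).
- rewrite (pd_pdM j i rf rg Dy) (pd_pdM i j rf rg Dy) (cf _ Dy) (cg _ Dy).
  move: (pd j (pd i f) y) (pd j (pd i g) y) (pd i f y) (pd j f y) (pd i g y)
    (pd j g y) (f y) (g y) => *.
  ring.
- have rpd h m : rational_on h -> rational_on (pd m h) by exact: rational_pd.
  have rV := rational_inv f0 rf.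
  have E p q : pd p (pd q (fun z => (f z)^-1)) y =
      - pd p (pd q f) y * ((f y)^-1 * (f y)^-1)
      + 2 * (pd q f y * pd p f y) * ((f y)^-1 * ((f y)^-1 * (f y)^-1)).
    have rN := rational_opp (rpd _ q rf).
    have rVV := rational_mul rV rV.
    rewrite (pd_ext _ (fun z => pdV q f0 rf (y:=z)) Dy) pdM ?pdM ?pdV ?pdN//;
      try exact: rpd.
    move: (pd p (pd q f) y) (pd q f y) (pd p f y) (f y)^-1 => *.
    ring.
  rewrite (E i j) (E j i) (cf _ Dy).
  by rewrite (mulrC (pd j f y)).
- have E p q : pd p (pd q g) y = pd p (pd q f) y.
    by apply/esym/pd_ext => // z Dz; apply: pd_ext.
  by rewrite (E i j) (E j i) (cf _ Dy).
Qed.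

Lemma rational_bigsum (m : nat) (f : 'I_m -> 'rV[R]_n -> R) :
  (forall k, rational_on (f k)) -> rational_on (fun y => \sum_k f k y).
Proof.
elim: m f => [|m IH] f rf.
  by apply: rational_ext (rational_cst 0) => y _; rewrite big_ord0.
apply: rational_ext (rational_add (rf ord0) (IH _ (fun k => rf (lift ord0 k)))).
by move=> y _; rewrite big_ord_recl.
Qed.

Lemma pd_bigsum (m : nat) (f : 'I_m -> 'rV[R]_n -> R) i y :
  (forall k, rational_on (f k)) -> D y ->
  pd i (fun z => \sum_k f k z) y = \sum_k pd i (f k) y.
Proof.
move=> rf Dy; apply: pd_val.
by apply: is_derive_bigsum => k; exact: rational_is_derive.
Qed.

Lemma rational_dot (u : 'rV[R]_n) : rational_on (dot u).
Proof.
apply: rational_bigsum => k.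
exact: rational_mul (rational_cst _) (rational_coord k).
Qed.

Lemma rational_quad (A : 'M[R]_n) : rational_on (quad A).
Proof.
apply: rational_bigsum => i; apply: rational_bigsum => j.
apply: rational_mul (rational_coord j).
exact: rational_mul (rational_cst _) (rational_coord i).
Qed.

End Rational.

(** * The geodesic spray of a Kropina metric in navigation data *)

Section Along.
Variables (R : realType) (n : nat).

(** For the partial derivatives [d] of a tensor field at a point, this is its
    derivative along the vector [v]. *)
Definition along m p (v : 'rV[R]_n) (d : 'I_n -> 'M[R]_(m, p)) : 'M[R]_(m, p) :=
  \sum_k v ord0 k *: d k.

Lemma alongE m p (v : 'rV[R]_n) (d : 'I_n -> 'M[R]_(m, p)) i j :
  along v d i j = \sum_k v ord0 k * d k i j.
Proof. by rewrite summxE; apply: eq_bigr => k _; rewrite mxE. Qed.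

Lemma dot_along (v u : 'rV[R]_n) (d : 'I_n -> 'rV[R]_n) :
  dot (along v d) u = \sum_k v ord0 k * dot (d k) u.
Proof. by rewrite dot_suml; apply: eq_bigr => k _; rewrite dotZl. Qed.

Lemma quad_along (v y : 'rV[R]_n) (d : 'I_n -> 'M[R]_n) :
  quad (along v d) y = \sum_k v ord0 k * quad (d k) y.
Proof.
rewrite quad_dot mulmx_sumr dot_suml; apply: eq_bigr => k _.
by rewrite -scalemxAr dotZl quad_dot.
Qed.

Lemma along_tr (v : 'rV[R]_n) (d : 'I_n -> 'M[R]_n) :
  (forall k, (d k)^T = d k) -> (along v d)^T = along v d.
Proof.
move=> ds; rewrite /along raddf_sum/=; apply: eq_bigr => k _.
by rewrite linearZ/= ds.
Qed.

End Along.

Lemma sym_mxE (R : realType) (n : nat) (A : 'M[R]_n) : A^T = A ->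
  forall i j, A i j = A j i.
Proof. by move=> As i j; rewrite -{1}As mxE. Qed.

(** The spray at a point depends on the navigation data through their 1-jet
    only.  Below, [h], [w], [V] are the values of the metric, of the covector
    and of the unit field, and [dh], [dw], [dV] those of their partial
    derivatives, so that all identities between them are algebraic. *)
Section KropinaJet.
Variables (R : realType) (n : nat) (h : 'M[R]_n) (w V : 'rV[R]_n).
Variables (dh : 'I_n -> 'M[R]_n) (dw dV : 'I_n -> 'rV[R]_n).
Implicit Types y : 'rV[R]_n.

(** The 1-jet form of [lie_metric]. *)
Definition lie_mx : 'M[R]_n := \matrix_(i, j) \sum_k
  (V ord0 k * dh k i j + h k j * dV i ord0 k + h i k * dV j ord0 k).

Definition fiber_F y : R := quad h y / (2 * dot w y).

Definition fiber_dF y : 'rV[R]_n := (dot w y)^-1 *: (y *m h - fiber_F y *: w).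

(** [h_lm Gam^m_00], with [Gam] the Christoffel symbols of the second kind. *)
Definition christoffel y : 'rV[R]_n :=
  \row_l ((y *m along y dh) ord0 l - 2^-1 * quad (dh l) y).

(** [S_l0], where [S] is half of the exterior derivative of the covector. *)
Definition curl y : 'rV[R]_n :=
  \row_l (2^-1 * (along y dw ord0 l - dot (dw l) y)).

(** [R_00], that is [W_(i|j) y^i y^j]; see [lie_formE]. *)
Definition lie_form y : R := 2^-1 * quad lie_mx y.

(** The spray with its index lowered by [h]: contracting the equations of the
    spray with [y] suggests that [F] is constant along geodesics, and this
    leaves a multiple of [dF] as the only unknown, fixed by contracting with
    the unit field. *)
Definition cospray y : 'rV[R]_n :=
  2^-1 *: christoffel y - fiber_F y *: curl y
  - (lie_form y / (2 * fiber_F y) + dot V (curl y))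
    *: (y *m h - fiber_F y *: w).

(** The fundamental tensor [dF (x) dF + F Hess F]; see [pd_pd_fiber_F2]. *)
Definition fiber_tensor y : 'M[R]_n := \matrix_(l, i)
  (fiber_dF y ord0 l * fiber_dF y ord0 i + fiber_F y *
   ((h l i - w ord0 l * fiber_dF y ord0 i - w ord0 i * fiber_dF y ord0 l)
     / dot w y)).

(** The derivatives of [fiber_F] and [fiber_dF] in the base directions. *)
Definition base_dF y k : R :=
  (quad (dh k) y - 2 * fiber_F y * dot (dw k) y) / (2 * dot w y).

Definition base_ddF y k l : R :=
  ((y *m dh k) ord0 l - base_dF y k * w ord0 l - fiber_F y * dw k ord0 l
   - fiber_dF y ord0 l * dot (dw k) y) / dot w y.

Definition euler_lagrange y l : R :=
  \sum_k 2 * (base_dF y k * fiber_dF y ord0 l + fiber_F y * base_ddF y k l)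
    * y ord0 k - 2 * fiber_F y * base_dF y l.

Hypothesis hs : h^T = h.
Hypothesis hpos : forall y, y != 0 -> 0 < quad h y.
Hypothesis wE : w = V *m h.
Hypothesis V1 : dot w V = 1.
Hypothesis dhs : forall k, (dh k)^T = dh k.
Hypothesis dwE : forall k, dw k = dV k *m h + V *m dh k.

Lemma lie_mx_tr : lie_mx^T = lie_mx.
Proof.
apply/matrixP => i j; rewrite !mxE; apply: eq_bigr => k _.
by rewrite (sym_mxE (dhs k) j) (sym_mxE hs k i) (sym_mxE hs j) addrAC.
Qed.

Lemma quad_lie_mx y :
  quad lie_mx y = quad (along V dh) y + 2 * dot (along y dV *m h) y.
Proof.
have E : lie_mx = along V dh
    + ((\matrix_i dV i) *m h + ((\matrix_i dV i) *m h)^T).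
  apply/matrixP => i j; rewrite mxE [RHS]mxE alongE !mxE -!big_split/=.
  apply: eq_bigr => k _; rewrite !mxE (sym_mxE hs k i); ring.
have YE : along y dV = y *m \matrix_i dV i.
  apply/rowP => j; rewrite alongE mxE; apply: eq_bigr => k _.
  by rewrite mxE.
rewrite E YE !quad_dot !mulmxDr !dotDl [dot (y *m _^T) y]dot_mulmx trmxK.
rewrite [dot y _]dotC !mulmxA; ring.
Qed.

(** The derivative of [w = h V] turns partial derivatives of [V] into those of
    [w], which identifies the Lie derivative with the symmetrized covariant
    derivative [w_(i,j) - w_m Gam^m_ij]. *)
Lemma lie_formE y :
  lie_form y = dot (along y dw) y - dot V (christoffel y).
Proof.
have adw : along y dw = along y dV *m h + V *m along y dh.
  rewrite mulmx_suml mulmx_sumr -big_split/=; apply: eq_bigr => k _.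
  by rewrite dwE scalerDr scalemxAl scalemxAr.
have VG : dot V (christoffel y)
    = dot V (y *m along y dh) - 2^-1 * quad (along V dh) y.
  rewrite quad_along mulr_sumr -sumrB; apply: eq_bigr => k _.
  rewrite mxE; ring.
rewrite /lie_form quad_lie_mx VG adw dotDl (dot_mulmx V) along_tr//.
lra.
Qed.

Lemma dot_christoffel y : dot y (christoffel y) = 2^-1 * quad (along y dh) y.
Proof.
have -> : dot y (christoffel y)
    = dot y (y *m along y dh) - 2^-1 * quad (along y dh) y.
  rewrite quad_along mulr_sumr -sumrB; apply: eq_bigr => k _.
  rewrite mxE; ring.
rewrite dotC -quad_dot; lra.
Qed.

Lemma dot_curl y : dot y (curl y) = 0.
Proof.
have -> : dot y (curl y)
    = 2^-1 * (dot y (along y dw) - dot (along y dw) y).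
  rewrite dot_along -sumrB mulr_sumr; apply: eq_bigr => k _.
  rewrite mxE; ring.
by rewrite dotC subrr mulr0.
Qed.

Lemma h_unit : h \in unitmx.
Proof.
rewrite -row_free_unit -kermx_eq0.
apply/negPn/negP => /matrix0Pn[i [j kij]].
have /hpos : row i (kermx h) != 0.
  by apply/eqP => /rowP/(_ j); rewrite [LHS]mxE [RHS]mxE; apply/eqP.
by rewrite quadE -row_mul mulmx_ker row0 mul0mx mxE ltxx.
Qed.

Section Direction.
Variable y : 'rV[R]_n.
Hypothesis wy : 0 < dot w y.

Lemma y_neq0 : y != 0.
Proof. by apply: contraTneq wy => ->; rewrite dotC dot0l ltxx. Qed.

Lemma fiber_F_gt0 : 0 < fiber_F y.
Proof. by rewrite divr_gt0 ?hpos ?y_neq0// mulr_gt0. Qed.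

Lemma quadF : quad h y = 2 * fiber_F y * dot w y.
Proof. by rewrite /fiber_F; field; rewrite gt_eqF. Qed.

Lemma dot_fiber_dF u :
  dot (fiber_dF y) u = (dot (y *m h) u - fiber_F y * dot w u) / dot w y.
Proof. by rewrite dotZl dotBl dotZl mulrC. Qed.

Lemma fiber_tensor_mul (u : 'rV[R]_n) l : (fiber_tensor y *m u^T) l ord0 =
  fiber_dF y ord0 l * dot (fiber_dF y) u + fiber_F y *
   (((u *m h) ord0 l - w ord0 l * dot (fiber_dF y) u
     - dot w u * fiber_dF y ord0 l) / dot w y).
Proof.
have -> : (u *m h) ord0 l = \sum_i h l i * u ord0 i.
  by rewrite mxE; apply: eq_bigr => i _; rewrite (sym_mxE hs l) mulrC.
rewrite /dot mulr_sumr mulr_sumr mulr_suml -sumrB -sumrB mulr_suml mulr_sumr.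
rewrite -big_split mxE/=; apply: eq_bigr => i _; rewrite !mxE.
ring.
Qed.

(** For [u] in the kernel, contraction with [y] gives [dF(u) = 0] by homogeneity
    of [F]; contraction with [u] itself then leaves [F h(u, u) / w(y) = 0]. *)
Lemma fiber_tensor_unit : fiber_tensor y \in unitmx.
Proof.
have wy0 := lt0r_neq0 wy; have F0 := lt0r_neq0 fiber_F_gt0.
rewrite -unitmx_tr -row_free_unit -kermx_eq0.
apply/negPn/negP => /matrix0Pn[i [j kij]].
set u := row i (kermx (fiber_tensor y)^T).
have u0 : u != 0.
  by apply/eqP => /rowP/(_ j); rewrite [LHS]mxE [RHS]mxE; apply/eqP.
have gu l : (fiber_tensor y *m u^T) l ord0 = 0.
  have : u *m (fiber_tensor y)^T = 0 by rewrite -row_mul mulmx_ker row0.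
  by move/(congr1 trmx); rewrite trmx_mul trmxK trmx0 => ->; rewrite mxE.
have con v : dot v (fiber_dF y) * dot (fiber_dF y) u + fiber_F y *
   ((dot v (u *m h) - dot v w * dot (fiber_dF y) u
     - dot w u * dot v (fiber_dF y)) / dot w y) = 0.
  transitivity (\sum_l v ord0 l * (fiber_tensor y *m u^T) l ord0).
    transitivity (dot v (dot (fiber_dF y) u *: fiber_dF y
      + (fiber_F y / dot w y) *: (u *m h - dot (fiber_dF y) u *: w
        - dot w u *: fiber_dF y))).
      move: (fiber_dF y) => d.
      rewrite dotDr !dotZr !dotBr !dotZr; ring.
    apply: eq_bigr => l _; rewrite fiber_tensor_mul; congr (_ * _).
    move: (fiber_dF y) (fiber_F y) (u *m h) => d f q; rewrite !mxE; ring.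
  by rewrite big1// => l _; rewrite gu mulr0.
have yF : dot y (fiber_dF y) = fiber_F y.
  by rewrite dotC dot_fiber_dF -quad_dot quadF; field.
have uh : dot y (u *m h) = dot (y *m h) u.
  by rewrite dotC dot_mulmx hs dotC.
have Fu : dot (fiber_dF y) u = 0.
  have := con y; rewrite yF uh (dotC y w).
  have -> : dot (y *m h) u
      = dot w y * dot (fiber_dF y) u + fiber_F y * dot w u.
    by rewrite dot_fiber_dF; field.
  move=> E; apply: (mulfI F0); rewrite mulr0 -[RHS]E; field => //.
have /eqP := con u; rewrite (dotC u (fiber_dF y)) Fu !(mulr0, subr0, add0r).
apply/negP; rewrite mulf_neq0// mulf_neq0 ?invr_eq0// dotC -quad_dot.
by rewrite gt_eqF// hpos.
Qed.

(** Only three scalars enter besides the [l]-th components: the contractions of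
    the spray with [y], with the unit field, and the norm of the latter.  Once
    they are computed, the equation is an identity of rational functions. *)
Lemma fiber_tensor_spray : fiber_tensor y *m (cospray y *m invmx h)^T
  = \col_l (4^-1 * euler_lagrange y l).
Proof.
have wy0 := lt0r_neq0 wy; have F0 := lt0r_neq0 fiber_F_gt0.
have hu := h_unit.
set G := cospray y *m invmx h.
have Gh : G *m h = cospray y by rewrite mulmxKV.
have wG : dot w G = dot V (cospray y).
  by rewrite wE dot_mulmx hs Gh.
have yG : dot (y *m h) G = dot y (cospray y) by rewrite dot_mulmx hs Gh.
have Vw : dot V w = 1 by rewrite dotC.
have Vy : dot V (y *m h) = dot w y by rewrite dotC dot_mulmx hs -wE dotC.
apply/colP => l; rewrite fiber_tensor_mul Gh [RHS]mxE.
rewrite dot_fiber_dF yG wG.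
have -> : euler_lagrange y l =
  2 * ((quad (along y dh) y - 2 * fiber_F y * dot (along y dw) y)
        / (2 * dot w y) * fiber_dF y ord0 l
    + fiber_F y * (((y *m along y dh) ord0 l
     - (quad (along y dh) y - 2 * fiber_F y * dot (along y dw) y)
        / (2 * dot w y) * w ord0 l
     - fiber_F y * along y dw ord0 l
     - fiber_dF y ord0 l * dot (along y dw) y) / dot w y))
  - 2 * fiber_F y * base_dF y l.
  congr (_ - _); rewrite quad_along dot_along alongE.
  have -> : (y *m along y dh) ord0 l = \sum_k y ord0 k * (y *m dh k) ord0 l.
    rewrite mulmx_sumr summxE; apply: eq_bigr => k _.
    by rewrite -scalemxAr mxE.
  set f := fiber_F y; set o := dot w y; set d := fiber_dF y ord0 l.
  transitivity (\sum_k
    ((d / o - f * w ord0 l / o ^+ 2) * (y ord0 k * quad (dh k) y)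
    + 2 * (f ^+ 2 * w ord0 l / o ^+ 2 - 2 * f * d / o)
      * (y ord0 k * dot (dw k) y)
    + 2 * f / o * (y ord0 k * (y *m dh k) ord0 l)
    + - (2 * f ^+ 2 / o) * (y ord0 k * dw k ord0 l))).
    apply: eq_bigr => k _; rewrite /base_ddF /base_dF -/f -/o -/d.
    by field.
  rewrite !big_split/= -!mulr_sumr.
  by field.
have cl : cospray y ord0 l = 2^-1 * ((y *m along y dh) ord0 l - 2^-1 * quad (dh l) y)
   - fiber_F y * (2^-1 * (along y dw ord0 l - dot (dw l) y))
   - (lie_form y / (2 * fiber_F y) + dot V (curl y))
      * ((y *m h) ord0 l - fiber_F y * w ord0 l).
  by rewrite !(mxE, alongE).
have Fl : fiber_dF y ord0 l = ((y *m h) ord0 l - fiber_F y * w ord0 l) / dot w y.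
  by rewrite !mxE mulrC.
have yc : dot y (cospray y) = 2^-1 * (2^-1 * quad (along y dh) y)
   - (lie_form y / (2 * fiber_F y) + dot V (curl y))
      * (fiber_F y * dot w y).
  rewrite !dotBr !dotZr dot_christoffel dot_curl dotBr dotZr.
  rewrite (dotC y (y *m h)) -quad_dot quadF (dotC y w); ring.
have Vc : dot V (cospray y) = 2^-1 * (dot (along y dw) y - lie_form y)
   - fiber_F y * dot V (curl y)
   - (lie_form y / (2 * fiber_F y) + dot V (curl y))
      * (dot w y - fiber_F y).
  rewrite !dotBr !dotZr dotBr dotZr Vw Vy lie_formE; ring.
rewrite yc Vc cl Fl /base_dF.
move: (lie_form y) (fiber_F y) F0 (dot V (curl y)) (dot w y) wy0
  (quad (along y dh) y) (dot (along y dw) y) ((y *m h) ord0 l) (w ord0 l)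
  ((y *m along y dh) ord0 l) (quad (dh l) y) (dot (dw l) y)
  (along y dw ord0 l) => K F F0 s om om0 *.
field.
by rewrite om0 F0.
Qed.

End Direction.
End KropinaJet.

(** * Derivatives along the fibre *)

Lemma cvg_dot (R : realType) (n : nat) (T : topologicalType) (f g : T -> 'rV[R]_n)
    (x : T) :
  (forall i, {for x, continuous (fun u => f u ord0 i)}) ->
  (forall i, {for x, continuous (fun u => g u ord0 i)}) ->
  {for x, continuous (fun u => dot (f u) (g u))}.
Proof.
move=> fc gc; rewrite /prop_for /continuous_at /dot.
apply: cvg_big => [|i _]; first exact: add_continuous.
by apply: cvgM; [exact: fc|exact: gc].
Qed.

Section FibreDerivatives.
Variables (R : realType) (n : nat) (h : 'M[R]_n) (w : 'rV[R]_n).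
Implicit Types y z : 'rV[R]_n.

Definition half_space : set 'rV[R]_n := [set z | 0 < dot w z].

Lemma half_space_open : open half_space.
Proof.
apply: (@open_comp _ _ (dot w) [set r | 0 < r]); last exact: open_gt.
move=> z _; apply: (@cvg_dot _ _ _ (fun=> w) id) => i; first exact: cst_continuous.
exact: coord_continuous.
Qed.

Hypothesis hs : h^T = h.

Lemma is_derive_dotr (u z v : 'rV[R]_n) : is_derive z v (dot u) (dot u v).
Proof.
apply: is_derive_eq (mx_derive_dot (mx_derive_cst z v u) (mx_derive_id z v)) _.
by rewrite dot0l add0r.
Qed.

Lemma is_derive_quad (A : 'M[R]_n) (z v : 'rV[R]_n) : A^T = A ->
  is_derive z v (quad A) (2 * dot (z *m A) v).
Proof.
move=> As.
apply: is_derive_eq (mx_derive_quad (mx_derive_id z v) (mx_derive_cst z v A) As) _.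
by rewrite quad_dot mulmx0 dot0l add0r.
Qed.

Lemma is_derive_fiber_F z v : 0 < dot w z ->
  is_derive z v (fiber_F h w) (dot (fiber_dF h w z) v).
Proof.
move=> wz; have w0 := lt0r_neq0 wz.
have d2 : is_derive z v (fun z => 2 * dot w z) (2 * dot w v).
  apply: is_derive_eq (is_derive_mul (is_derive_cst (2 : R) _ _) (is_derive_dotr w z v)) _.
  by rewrite /cst mul0r add0r.
apply: is_derive_eq (is_derive_quot (is_derive_quad _ _ hs) d2 _) _.
  by rewrite mulf_neq0.
rewrite dotZl dotBl dotZl /fiber_F; by field.
Qed.

Lemma is_derive_fiber_dF z i l : 0 < dot w z ->
  is_derive z (delta_mx ord0 i) (fun z => fiber_dF h w z ord0 l)
   ((h l i - w ord0 l * fiber_dF h w z ord0 i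
     - w ord0 i * fiber_dF h w z ord0 l) / dot w z).
Proof.
move=> wz; have w0 := lt0r_neq0 wz.
have dF := is_derive_fiber_F (delta_mx ord0 i) wz; rewrite dot_deltar in dF.
have dw := is_derive_dotr w z (delta_mx ord0 i); rewrite dot_deltar in dw.
have dh := mx_derive_mul (mx_derive_id z (delta_mx ord0 i))
  (mx_derive_cst z (delta_mx ord0 i) h) ord0 l.
have dn := is_derive_sub dh (is_derive_mul dF (is_derive_cst (w ord0 l) _ _)).
rewrite [X in is_derive _ _ X _](_ : _ = fun z =>
  ((z *m h) ord0 l - fiber_F h w z * w ord0 l) / dot w z); last first.
  by apply/funext => u; rewrite !mxE mulrC.
apply: is_derive_eq (is_derive_quot dn dw w0) _.
have -> : (delta_mx ord0 i *m h + z *m 0) ord0 l = h l i.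
  by rewrite mulmx0 addr0 -rowE mxE (sym_mxE hs).
have -> : fiber_dF h w z ord0 l
    = ((z *m h) ord0 l - fiber_F h w z * w ord0 l) / dot w z.
  by rewrite !mxE mulrC.
rewrite mulr0 addr0.
congr (_ / _).
rewrite /cst; ring.
Qed.

Lemma pd_fiber_F2 z l : 0 < dot w z ->
  pd l (fun z => fiber_F h w z ^+ 2) z
  = 2 * fiber_F h w z * fiber_dF h w z ord0 l.
Proof.
move=> wz; apply: pd_val.
have dF := is_derive_fiber_F (delta_mx ord0 l) wz; rewrite dot_deltar in dF.
apply: is_derive_eq (is_derive_mul dF dF) _; ring.
Qed.

Lemma pd_pd_fiber_F2 z i l : 0 < dot w z ->
  pd i (pd l (fun z => fiber_F h w z ^+ 2)) z = 2 * fiber_tensor h w z l i.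
Proof.
move=> wz; have oH := half_space_open.
rewrite (pd_ext oH i (fun u => @pd_fiber_F2 u l) wz); apply: pd_val.
have dF := is_derive_fiber_F (delta_mx ord0 i) wz; rewrite dot_deltar in dF.
apply: is_derive_eq (is_derive_mul (is_derive_mul (is_derive_cst (2 : R) _ _) dF)
  (is_derive_fiber_dF i l wz)) _; rewrite /cst.
rewrite [in RHS]mxE; move: (fiber_dF h w z) => d; ring.
Qed.

End FibreDerivatives.

(** * The function whose Hessian obstructs the Killing equation *)

Lemma dot_skew (R : realType) (n : nat) (C : 'M[R]_n) (u : 'rV[R]_n) :
  C^T = - C -> dot (u *m C) u = 0.
Proof.
move=> Cs; have : dot (u *m C) u = - dot (u *m C) u.
  by rewrite {1}dot_mulmx Cs mulmxN dotC dotNl.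
lra.
Qed.

Lemma sum_quad_rank1 (R : realType) (n : nat) (A : 'M[R]_n) c
    (a b v : 'rV[R]_n) :
  \sum_i \sum_j v ord0 i * v ord0 j * (c * A i j + a ord0 i * b ord0 j
    + a ord0 j * b ord0 i) = c * quad A v + 2 * dot a v * dot b v.
Proof.
transitivity (c * quad A v
    + ((\sum_i a ord0 i * v ord0 i) * (\sum_j b ord0 j * v ord0 j)
    + (\sum_i b ord0 i * v ord0 i) * (\sum_j a ord0 j * v ord0 j))).
  rewrite /quad [X in _ = X + _]mulr_sumr !big_distrlr -!big_split/=.
  apply: eq_bigr => i _; rewrite mulr_sumr -!big_split/=.
  apply: eq_bigr => j _; ring.
rewrite -!/(dot _ _); ring.
Qed.

Section Defect.
Variables (R : realType) (n : nat) (h L : 'M[R]_n) (w : 'rV[R]_n).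
Implicit Types y z v : 'rV[R]_n.

(** [R_00 / (2 F)] when [L] is the Lie derivative of [h]. *)
Definition defect z : R := 2^-1 * quad L z * dot w z / quad h z.

Hypothesis hs : h^T = h.
Hypothesis hpos : forall y, y != 0 -> 0 < quad h y.
Hypothesis Ls : L^T = L.

Lemma quad_neq0 z : half_space w z -> quad h z != 0.
Proof. by move=> /y_neq0 /hpos/lt0r_neq0. Qed.

Lemma rational_defect : rational_on (half_space w) defect.
Proof.
apply: rational_mul; last exact: (rational_inv quad_neq0 (rational_quad _ h)).
apply: rational_mul (rational_dot _ w).
exact: rational_mul (rational_cst _ _) (rational_quad _ L).
Qed.

Lemma is_derive_half_quad z v :
  is_derive z v (fun z => 2^-1 * quad L z) (dot (z *m L) v).
Proof.
apply: is_derive_eq (is_derive_mul (is_derive_cst (2^-1 : R) _ _)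
  (is_derive_quad z v Ls)) _.
by rewrite /cst; field.
Qed.

Lemma pd_defect z i : 0 < dot w z -> pd i defect z =
  ((z *m L) ord0 i * dot w z + 2^-1 * quad L z * w ord0 i
   - defect z * (2 * (z *m h) ord0 i)) / quad h z.
Proof.
move=> wz; apply: pd_val.
have := is_derive_quot (is_derive_mul (is_derive_half_quad z (delta_mx ord0 i))
  (is_derive_dotr w z (delta_mx ord0 i))) (is_derive_quad z (delta_mx ord0 i) hs)
  (quad_neq0 wz).
by rewrite !dot_deltar.
Qed.

(** Euler's relation: the function is homogeneous of degree 1. *)
Lemma defect_euler z : 0 < dot w z ->
  \sum_i pd i defect z * z ord0 i = defect z.
Proof.
move=> wz; have H0 := quad_neq0 wz.
transitivity (dot w z / quad h z * dot (z *m L) z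
  + 2^-1 * quad L z / quad h z * dot w z
  + - (2 * defect z / quad h z) * dot (z *m h) z); last first.
  rewrite -!quad_dot /defect; by field.
rewrite /dot [X in X + _ + _]mulr_sumr [X in _ + X + _]mulr_sumr.
rewrite [X in _ + X]mulr_sumr -!big_split/=.
apply: eq_bigr => i _; rewrite pd_defect//.
by rewrite -!/(dot _ _); field.
Qed.

(** The product [defect * H] is a cubic polynomial: comparing its first and
    second derivatives along [v] with those given by the Leibniz rule yields two
    equations, in which [g] is the derivative of [defect] along [v]. *)
Lemma defect_hess v z : 0 < dot w z -> dot w v = 0 ->
  (forall i j, pd j (pd i defect) z = 0) ->
  exists g, g * quad h z + defect z * (2 * dot (z *m h) v)
      = dot (z *m L) v * dot w z
    /\ 4 * g * dot (z *m h) v + 2 * defect z * quad h v = quad L v * dot w z.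
Proof.
move=> wz wv hess0; have H0 := quad_neq0 wz.
have oH := half_space_open (w := w).
exists (\sum_i v ord0 i * pd i defect z); split.
  transitivity (\sum_i v ord0 i * (pd i defect z * quad h z
      + defect z * (2 * (z *m h) ord0 i))).
    rewrite /dot mulr_suml 2!mulr_sumr -big_split/=.
    apply: eq_bigr => i _; ring.
  transitivity (\sum_i v ord0 i * ((z *m L) ord0 i * dot w z
      + 2^-1 * quad L z * w ord0 i)).
    by apply: eq_bigr => i _; rewrite pd_defect//; field.
  transitivity (dot (z *m L) v * dot w z + 2^-1 * quad L z * dot w v).
    rewrite [X in _ = X * _ + _]/dot mulr_suml.
    rewrite [X in _ = _ + _ * X]/dot mulr_sumr -big_split/=.
    apply: eq_bigr => i _; ring.
  by rewrite wv mulr0 addr0.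
have rq A : rational_on (half_space w) (quad A) by exact: rational_quad.
have rl : rational_on (half_space w) (fun u => 2^-1 * quad L u).
  exact: rational_mul (rational_cst _ _) (rq L).
have dq (A : 'M[R]_n) i u : A^T = A -> pd i (quad A) u = 2 * (u *m A) ord0 i.
  move=> As; apply: pd_val; rewrite -dot_deltar; exact: is_derive_quad.
have ddq (A : 'M[R]_n) i j : A^T = A -> pd j (pd i (quad A)) z = 2 * A i j.
  move=> As; have -> : pd i (quad A) = fun u => 2 * (u *m A) ord0 i.
    by apply/funext => t; exact: dq.
  apply: pd_val.
  apply: is_derive_eq (is_derive_mul (is_derive_cst (2 : R) _ _)
    (mx_derive_mul (mx_derive_id _ _) (mx_derive_cst _ _ A) _ _)) _.
  by rewrite mul0r mulmx0 addr0 -rowE mxE add0r (sym_mxE As).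
have E i j : pd j defect z * (2 * (z *m h) ord0 i)
  + pd i defect z * (2 * (z *m h) ord0 j) + defect z * (2 * h i j)
  = L i j * dot w z + (z *m L) ord0 i * w ord0 j + (z *m L) ord0 j * w ord0 i.
  have : pd j (pd i (fun u => defect u * quad h u)) z
      = pd j (pd i (fun u => 2^-1 * quad L u * dot w u)) z.
    apply: (pd_ext oH _ _ wz) => u wu; apply: (pd_ext oH _ _ wu) => t wt.
    by rewrite /defect divfK// quad_neq0.
  rewrite (pd_pdM oH i j rational_defect (rq h) wz).
  rewrite (pd_pdM oH i j rl (rational_dot _ w) wz).
  rewrite hess0 mul0r add0r (ddq h)// !(dq h)//.
  have dw k : pd k (dot w) = fun=> w ord0 k.
    apply/funext => u; apply: pd_val; rewrite -dot_deltar.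
    exact: is_derive_dotr.
  have dK k : pd k (fun u => 2^-1 * quad L u) = fun u => (u *m L) ord0 k.
    apply/funext => u; apply: pd_val; rewrite -dot_deltar.
    exact: is_derive_half_quad.
  have dzL k m : pd m (fun u => (u *m L) ord0 k) z = L k m.
    apply: pd_val; apply: is_derive_eq (mx_derive_mul (mx_derive_id _ _)
      (mx_derive_cst _ _ L) _ _) _.
    by rewrite mulmx0 addr0 -rowE mxE (sym_mxE Ls).
  rewrite !dw !dK dzL pd_cst mulr0 addr0.
  move: (pd i defect z) (pd j defect z) => di dj.
  by move=> <-; ring.
pose b := \row_j pd j defect z.
have gE : dot b v = \sum_i v ord0 i * pd i defect z.
  by apply: eq_bigr => i _; rewrite mxE mulrC.
have := sum_quad_rank1 h (2 * defect z) (2 *: (z *m h)) b v.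
have := sum_quad_rank1 L (dot w z) (z *m L) w v.
rewrite wv mulr0 addr0 gE dotZl [RHS]mulrC => <- Eh.
transitivity (2 * defect z * quad h v
  + 2 * (2 * dot (z *m h) v) * (\sum_i v ord0 i * pd i defect z)).
  ring.
rewrite -Eh; apply: eq_bigr => i _; apply: eq_bigr => j _; congr (_ * _).
rewrite (mulrC (dot w z)) -E; move: (z *m h) => q; rewrite !mxE.
move: (pd i defect z) (pd j defect z) => di dj; ring.
Qed.

(** At the unit vector [V] itself, the second derivative along [v] orthogonal to
    [V] gives [L(v, v) = 0].  At [V + s v] it then gives
    [g (3 - s^2 h(v, v)) = 0] with [g] proportional to [L(V, v)], which has to be
    used for two values of [s] to avoid the zero of the second factor. *)
Lemma defect_hess_eq0 V : dot w V = 1 -> w = V *m h -> quad L V = 0 ->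
  (forall z, 0 < dot w z -> forall i j, pd j (pd i defect) z = 0) -> L = 0.
Proof.
move=> V1 wE LV hess0.
have line v s : dot w v = 0 -> exists f g,
  [/\ f * (1 + s ^+ 2 * quad h v)
      = s * dot (V *m L) v + 2^-1 * s ^+ 2 * quad L v,
    g * (1 + s ^+ 2 * quad h v) + 2 * s * f * quad h v
      = dot (V *m L) v + s * quad L v
    & 4 * s * g * quad h v + 2 * f * quad h v = quad L v].
  move=> wv; pose z := V + s *: v.
  have wz : dot w z = 1 by rewrite dotDr dotZr wv V1 mulr0 addr0.
  have wz0 : 0 < dot w z by rewrite wz.
  have zh : z *m h = w + s *: (v *m h) by rewrite mulmxDl -wE scalemxAl.
  have zL : z *m L = V *m L + s *: (v *m L) by rewrite mulmxDl scalemxAl.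
  have zhv : dot (z *m h) v = s * quad h v.
    by rewrite zh dotDl wv add0r dotZl quad_dot.
  have zLv : dot (z *m L) v = dot (V *m L) v + s * quad L v.
    by rewrite zL dotDl dotZl quad_dot.
  have Hz : quad h z = 1 + s ^+ 2 * quad h v.
    rewrite quad_dot {2}/z dotDr dotZr zhv zh dotDl V1 dotZl.
    rewrite dot_mulmx hs -wE dotC wv; ring.
  have Lz : quad L z = 2 * s * dot (V *m L) v + s ^+ 2 * quad L v.
    rewrite quad_dot {2}/z dotDr dotZr zLv zL dotDl dotZl.
    rewrite -(quad_dot L V) LV (dot_mulmx v) Ls (dotC v); ring.
  have [g [+ +]] := defect_hess wz0 wv (hess0 z wz0).
  rewrite wz !mulr1 zhv => g1 g2.
  have H0 := quad_neq0 wz0.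
  have fH : defect z * quad h z = 2^-1 * quad L z by rewrite /defect divfK// wz mulr1.
  exists (defect z), g; split.
  - rewrite -Hz fH Lz; by field.
  - rewrite -Hz -zLv -g1; ring.
  - rewrite -g2; ring.
have perp v : dot w v = 0 -> quad L v = 0 /\ dot (V *m L) v = 0.
  move=> wv; have [->|/hpos p0] := eqVneq v 0.
    by rewrite quad_dot !dot0r.
  have q0 : quad L v = 0.
    have [f [g [+ _]]] := line v 0 wv.
    by rewrite expr0n /= !(mul0r, mulr0, addr0, mulr1) => ->; rewrite mulr0 mul0r addr0.
  split=> //.
  have s_line s : s != 0 -> s ^+ 2 * quad h v != 3 -> dot (V *m L) v = 0.
    move=> s0 sp; have [f [g [e1 e2 e3]]] := line v s wv.
    rewrite q0 in e1 e2 e3.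
    have fg : f = - (2 * s * g).
      apply: (mulIf (lt0r_neq0 p0)); lra.
    have eg : dot (V *m L) v = - 2 * g * (1 + s ^+ 2 * quad h v).
      apply: (mulfI s0); rewrite mulr0 addr0 in e1; rewrite -e1 fg; ring.
    have /eqP : g * (3 - s ^+ 2 * quad h v) = 0.
      transitivity (g * (1 + s ^+ 2 * quad h v) + 2 * s * f * quad h v
        - dot (V *m L) v); first by rewrite eg fg; ring.
      by rewrite e2; ring.
    rewrite mulf_eq0 subr_eq0 [3 == _]eq_sym (negbTE sp) orbF => /eqP g0.
    by rewrite eg g0 mulr0 mul0r.
  have [p3|p3] := eqVneq (quad h v) 3.
    (* here 3 - s ^+ 2 * quad h v vanishes at s = 1, and equals - 9 at s = 2 *)
    apply: (s_line 2); rewrite ?pnatr_eq0// p3.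
    by apply/eqP; lra.
  by apply: (s_line 1); rewrite ?oner_eq0// expr1n mul1r.
have Lq y : quad L y = 0.
  pose v := y - dot w y *: V.
  have wv : dot w v = 0 by rewrite dotBr dotZr V1 mulr1 subrr.
  have [Lv LVv] := perp _ wv.
  have -> : y = v + dot w y *: V by rewrite subrK.
  move: v (dot w y) Lv LVv {wv} => v c Lv LVv.
  rewrite quad_dot mulmxDl dotDl !dotDr -(quad_dot L v) Lv -scalemxAl.
  rewrite !dotZl !dotZr LVv -(quad_dot L V) LV dot_mulmx Ls dotC LVv; ring.
apply/matrixP => i j; rewrite mxE.
have qd k m : dot (delta_mx ord0 k *m L) (delta_mx ord0 m) = L k m.
  by rewrite dot_deltar -rowE mxE.
have := Lq (delta_mx ord0 i + delta_mx ord0 j).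
rewrite quad_dot mulmxDl dotDl !dotDr -!quad_dot !Lq !qd (sym_mxE Ls j).
lra.
Qed.

End Defect.

(** * The divergence of the spray along the fibre *)

Section Divergence.
Variables (R : realType) (n : nat) (h : 'M[R]_n) (w V : 'rV[R]_n).
Variables (dh : 'I_n -> 'M[R]_n) (dw dV : 'I_n -> 'rV[R]_n).
Implicit Types y z : 'rV[R]_n.

Hypothesis hs : h^T = h.
Hypothesis hpos : forall y, y != 0 -> 0 < quad h y.
Hypothesis wE : w = V *m h.
Hypothesis V1 : dot w V = 1.
Hypothesis dhs : forall k, (dh k)^T = dh k.

Let L := lie_mx h V dh dV.
Let phi := defect h L w.

Definition curl_mx : 'M[R]_n :=
  \matrix_(k, l) (2^-1 * (dw k ord0 l - dw l ord0 k)).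

Lemma curl_mx_tr : curl_mx^T = - curl_mx.
Proof. by apply/matrixP => i j; rewrite !mxE -mulrN opprB. Qed.

Lemma curlE z : curl dw z = z *m curl_mx.
Proof.
apply/rowP => l; rewrite !mxE alongE /dot -sumrB mulr_sumr.
apply: eq_bigr => k _; rewrite mxE; ring.
Qed.

(** [S_0] as a covector: [dot curl_dual y = V^i S_i0]. *)
Definition curl_dual : 'rV[R]_n := V *m curl_mx^T.

Definition christoffel_mx l : 'M[R]_n :=
  \matrix_(i, j) (dh i j l - 2^-1 * dh l i j).

Lemma christoffelE z l : christoffel dh z ord0 l = quad (christoffel_mx l) z.
Proof.
have -> : quad (christoffel_mx l) z =
   \sum_i \sum_j dh i j l * z ord0 i * z ord0 j - 2^-1 * quad (dh l) z.
  rewrite /quad mulr_sumr -sumrB; apply: eq_bigr => i _.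
  rewrite mulr_sumr -sumrB; apply: eq_bigr => j _; rewrite mxE; ring.
rewrite mxE; congr (_ - _); rewrite mulmx_sumr summxE; apply: eq_bigr => i _.
rewrite -scalemxAr !mxE mulr_sumr; apply: eq_bigr => j _; ring.
Qed.

(** The coefficients of the quadratic part of the spray. *)
Definition spray_mx r : 'M[R]_n :=
  2^-1 *: (\sum_l invmx h l r *: christoffel_mx l)
  + (4^-1 * V ord0 r) *: L - curl_dual^T *m delta_mx ord0 r.

Lemma quad_spray_mx r z : quad (spray_mx r) z =
  2^-1 * (christoffel dh z *m invmx h) ord0 r
  + 2^-1 * lie_form h V dh dV z * V ord0 r
  - dot V (curl dw z) * z ord0 r.
Proof.
rewrite quad_dot mulmxBr mulmxDr dotBl dotDl; congr (_ + _ - _).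
- rewrite -scalemxAr dotZl; congr (_ * _).
  rewrite mulmx_sumr dot_suml mxE; apply: eq_bigr => l _.
  by rewrite -scalemxAr dotZl -quad_dot -christoffelE mulrC.
- by rewrite -scalemxAr dotZl -quad_dot /lie_form -/L; field.
- rewrite mulmxA (mx11_scalar (z *m _)) mul_scalar_mx -dotE dotZl.
  rewrite (dotC (delta_mx _ _)) dot_deltar; congr (_ * _).
  by rewrite curlE (dotC V) dot_mulmx.
Qed.

(** Separates the part that is quadratic in [y], whose divergence is linear
    whatever its coefficients are, from the three terms that involve [F]. *)
Lemma spray_split r z : 0 < dot w z ->
  (cospray h w V dh dw dV z *m invmx h) ord0 r =
  quad (spray_mx r) z
  - fiber_F h w z * (z *m (curl_mx *m invmx h)) ord0 r
  + fiber_F h w z * (dot curl_dual z * V ord0 r)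
  - phi z * z ord0 r.
Proof.
move=> wz; have w0 := lt0r_neq0 wz; have H0 := lt0r_neq0 (hpos (y_neq0 wz)).
have F0 := lt0r_neq0 (fiber_F_gt0 hpos wz).
have hu := h_unit hpos.
have phiE : phi z = lie_form h V dh dV z / (2 * fiber_F h w z).
  rewrite /phi /defect /fiber_F /lie_form -/L; field.
  by rewrite H0 w0.
have Vc : dot V (curl dw z) = dot curl_dual z.
  by rewrite curlE dotC dot_mulmx dotC.
rewrite /cospray mulmxBl mulmxBl -!scalemxAl mulmxBl -scalemxAl.
rewrite mulmxK// wE mulmxK// -wE quad_spray_mx curlE mulmxA phiE -curlE Vc.
move: (lie_form _ _ _ _ _) (fiber_F h w z) F0 (dot curl_dual z) => K F F0 c.
move: (_ *m invmx h) (_ *m invmx h) => A B.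
rewrite !mxE; by field.
Qed.

Lemma rational_spray r : rational_on (half_space w)
  (fun z => (cospray h w V dh dw dV z *m invmx h) ord0 r).
Proof.
have rc c := rational_cst (half_space w) c.
have rF : rational_on (half_space w) (fiber_F h w).
  apply: rational_mul (rational_quad _ h) _.
  apply: rational_inv (rational_mul (rc 2) (rational_dot _ w)) => z wz.
  by rewrite mulf_neq0 ?lt0r_neq0.
have rN : rational_on (half_space w)
    (fun z => (z *m (curl_mx *m invmx h)) ord0 r).
  apply: rational_ext (rational_dot _ (row r (curl_mx *m invmx h)^T)) => z _.
  by rewrite mulmx_dot.
have rp : rational_on (half_space w) phi.
  by apply: rational_defect.
apply: rational_ext (fun z wz => esym (spray_split r wz)) _.
apply: rational_sub (rational_mul rp (rational_coord _ r)).
apply: rational_add (rational_mul rF (rational_mul (rational_dot _ _) (rc _))).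
exact: rational_sub (rational_quad _ _) (rational_mul rF rN).
Qed.

Lemma pd_spray r z : 0 < dot w z ->
  pd r (fun z => (cospray h w V dh dw dV z *m invmx h) ord0 r) z =
  dot (row r (spray_mx r) + row r (spray_mx r)^T) z
  - (fiber_dF h w z ord0 r * (z *m (curl_mx *m invmx h)) ord0 r
     + fiber_F h w z * (curl_mx *m invmx h) r r)
  + (fiber_dF h w z ord0 r * V ord0 r * dot curl_dual z
     + fiber_F h w z * (curl_dual ord0 r * V ord0 r))
  - (pd r phi z * z ord0 r + phi z).
Proof.
move=> wz; have oH := half_space_open (w := w).
have Ls : L^T = L by exact: lie_mx_tr.
rewrite (pd_ext oH _ (fun z wz => spray_split r wz) wz); apply: pd_val.
set e := delta_mx ord0 r.
have dQ := mx_derive_dot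
  (mx_derive_mul (mx_derive_id z e) (mx_derive_cst z e (spray_mx r)))
  (mx_derive_id z e).
have dF := is_derive_fiber_F hs e wz.
have dN := mx_derive_mul (mx_derive_id z e)
  (mx_derive_cst z e (curl_mx *m invmx h)) ord0 r.
have dc := is_derive_mul (is_derive_dotr curl_dual z e)
  (is_derive_cst (V ord0 r) z e).
have dp := rational_is_derive oH r (rational_defect L w hpos) wz.
have dz := mx_derive_id z e ord0 r.
rewrite [X in is_derive _ _ X _](_ : _ = fun z => dot (z *m spray_mx r) z
  - fiber_F h w z * (z *m (curl_mx *m invmx h)) ord0 r
  + fiber_F h w z * (dot curl_dual z * cst (V ord0 r) z)
  - phi z * z ord0 r); last by apply/funext => u; rewrite quad_dot.
apply: is_derive_eq (is_derive_sub (is_derive_add (is_derive_sub dQ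
  (is_derive_mul dF dN)) (is_derive_mul dF dc)) (is_derive_mul dp dz)) _.
rewrite !mulmx0 !addr0 mulr0 addr0 !dot_deltar dotDl /cst.
have -> : e ord0 r = 1 by rewrite mxE !eqxx.
have -> : (e *m (curl_mx *m invmx h)) ord0 r = (curl_mx *m invmx h) r r.
  by rewrite -rowE mxE.
rewrite -mulmx_dot -rowE -/phi; ring.
Qed.

(** The trace of [S] vanishes by skewness, the derivatives of [F] along [S^i_0]
    and along the unit field combine into the linear function [S_0], and Euler's
    relation turns the divergence of [- phi y] into [- (n + 1) phi]. *)
Lemma spray_divergence : exists q, forall z, 0 < dot w z ->
  \sum_r pd r (fun z => (cospray h w V dh dw dV z *m invmx h) ord0 r) z
  = dot q z - n.+1%:R * phi z.
Proof.
exists (\sum_r (row r (spray_mx r) + row r (spray_mx r)^T) + curl_dual) => z wz.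
have w0 := lt0r_neq0 wz.
have Ls : L^T = L by exact: lie_mx_tr.
rewrite (eq_bigr _ (fun r _ => pd_spray r wz)) !(sumrB, big_split)/=.
have -> : \sum_(r < n) phi z = n%:R * phi z.
  by rewrite sumr_const card_ord mulr_natl.
rewrite -dot_suml big_split/= [X in _ = X - _]dotDl (defect_euler hs hpos Ls wz).
rewrite -mulr_suml -!mulr_sumr -!/(dot _ _) -/(\tr _).
have hu := h_unit hpos.
have trN : \tr (curl_mx *m invmx h) = 0.
  have : \tr (curl_mx *m invmx h) = - \tr (curl_mx *m invmx h).
    rewrite -{1}mxtrace_tr trmx_mul trmx_inv hs curl_mx_tr mulmxN raddfN/=.
    by rewrite mxtrace_mulC.
  lra.
have cV : dot curl_dual V = 0.
  by apply: dot_skew; rewrite curl_mx_tr linearN/= curl_mx_tr.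
have dFV : dot (fiber_dF h w z) V = (dot w z - fiber_F h w z) / dot w z.
  by rewrite dot_fiber_dF dot_mulmx hs -wE V1 mulr1 dotC.
have dFN : dot (fiber_dF h w z) (z *m (curl_mx *m invmx h))
    = - fiber_F h w z * dot curl_dual z / dot w z.
  rewrite dot_fiber_dF dot_mulmx hs wE dot_mulmx hs mulmxA mulmxKV//.
  rewrite (dotC z) (dot_skew z curl_mx_tr) sub0r (dotC V) dot_mulmx.
  by rewrite (dotC z) !mulNr.
rewrite trN cV dFV dFN -/phi.
move: (fiber_F h w z) (dot curl_dual z) => F c.
rewrite -natr1; field.
exact: w0.
Qed.

End Divergence.

(** * From navigation data in a chart to the mean Berwald tensor *)

Section Chart.
Variables (R : realType) (n : nat) (U : set 'rV[R]_n) (x : 'rV[R]_n).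
Variables (F : 'rV[R]_n -> 'rV[R]_n -> R).
Variables (h : 'rV[R]_n -> 'M[R]_n) (w V : 'rV[R]_n -> 'rV[R]_n).
Variables (dh : 'I_n -> 'M[R]_n) (dw dV : 'I_n -> 'rV[R]_n).

Hypothesis oU : open U.
Hypothesis Ux : U x.
Hypothesis FE : forall u, U u -> F u = fiber_F (h u) (w u).
Hypothesis hs : forall u, U u -> (h u)^T = h u.
Hypothesis hpos : forall u, U u -> forall y, y != 0 -> 0 < quad (h u) y.
Hypothesis wE : forall u, U u -> w u = V u *m h u.
Hypothesis V1 : forall u, U u -> dot (w u) (V u) = 1.
Hypothesis h_der : forall k, mx_derive x (delta_mx ord0 k) h (dh k).
Hypothesis w_der : forall k, mx_derive x (delta_mx ord0 k) w (dw k).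
Hypothesis V_der : forall k, mx_derive x (delta_mx ord0 k) V (dV k).
Hypothesis w_near : forall y, 0 < dot (w x) y -> \near x, 0 < dot (w x) y.

Lemma near_chart (P : 'rV[R]_n -> Prop) : (forall u, U u -> P u) -> \near x, P x.
Proof. exact: near_on. Qed.

Lemma dh_tr k : (dh k)^T = dh k.
Proof.
have ht : mx_derive x (delta_mx ord0 k) (fun u => (h u)^T) (dh k)^T.
  move=> i j; rewrite mxE; have := h_der k j i.
  by rewrite (_ : (fun u => h u j i) = fun u => (h u)^T i j)//;
    apply/funext => u; rewrite mxE.
apply: mx_derive_unique ht _; apply: mx_derive_near (h_der k).
by apply: near_chart => u /hs.
Qed.

Lemma dw_eq k : dw k = dV k *m h x + V x *m dh k.
Proof.
apply: mx_derive_unique (w_der k) _.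
apply: mx_derive_near (mx_derive_mul (V_der k) (h_der k)).
by apply: near_chart => u /wE.
Qed.

(** The derivative of [h(V, V) = 1] along [V]. *)
Lemma lie_mx_unit : quad (lie_mx (h x) (V x) dh dV) (V x) = 0.
Proof.
have hsx := hs Ux; have dhs := dh_tr.
rewrite quad_lie_mx//.
rewrite quad_along dot_mulmx hsx -wE// dot_along mulr_sumr -big_split big1// => k _.
have d1 := mx_derive_dot (w_der k) (V_der k).
have d0 : is_derive x (delta_mx ord0 k) (fun u => dot (w u) (V u)) 0.
  apply: near_eq_is_derive (is_derive_cst (1 : R) _ _).
  by apply: near_chart => u /V1.
have : dot (dw k) (V x) + dot (w x) (dV k) = 0.
  by rewrite -(@derive_val _ _ _ _ _ _ _ d1) (@derive_val _ _ _ _ _ _ _ d0).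
rewrite dw_eq dotDl dot_mulmx hsx -wE// -quad_dot (dotC (w x)) => E.
transitivity (V x ord0 k * (dot (dV k) (w x) + quad (dh k) (V x)
  + dot (dV k) (w x))); last by rewrite E mulr0.
rewrite /=; ring.
Qed.

Section Direction.
Variable y : 'rV[R]_n.
Hypothesis wy : 0 < dot (w x) y.

Lemma fundamental_tensorE :
  fundamental_tensor F x y = fiber_tensor (h x) (w x) y.
Proof.
apply/matrixP => i j; rewrite mxE FE// pd_pd_fiber_F2 ?hs//.
have -> : fiber_tensor (h x) (w x) y j i = fiber_tensor (h x) (w x) y i j.
  rewrite [LHS]mxE [RHS]mxE; move: (fiber_dF _ _ _) => d.
  rewrite (sym_mxE (hs Ux) j); ring.
by field.
Qed.

Lemma is_derive_base_F k :
  is_derive x (delta_mx ord0 k) (fun u => fiber_F (h u) (w u) y)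
    (base_dF (h x) (w x) dh dw y k).
Proof.
have w0 := lt0r_neq0 wy.
have dq := mx_derive_quad (mx_derive_cst x (delta_mx ord0 k) y) (h_der k) (hs Ux).
have dwy := mx_derive_dot (w_der k) (mx_derive_cst x (delta_mx ord0 k) y).
have d2 := is_derive_mul (is_derive_cst (2 : R) _ _) dwy.
apply: is_derive_eq (is_derive_quot dq d2 _) _; first by rewrite /cst mulf_neq0.
rewrite /base_dF !dot0r /fiber_F /cst /=.
by field.
Qed.

Lemma is_derive_base_dF k l :
  is_derive x (delta_mx ord0 k) (fun u => fiber_dF (h u) (w u) y ord0 l)
    (base_ddF (h x) (w x) dh dw y k l).
Proof.
have w0 := lt0r_neq0 wy.
have dn := is_derive_sub
  (mx_derive_mul (mx_derive_cst x (delta_mx ord0 k) y) (h_der k) ord0 l)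
  (is_derive_mul (is_derive_base_F k) (w_der k ord0 l)).
have dwy := mx_derive_dot (w_der k) (mx_derive_cst x (delta_mx ord0 k) y).
rewrite [X in is_derive _ _ X _](_ : _ = fun u =>
  ((y *m h u) ord0 l - fiber_F (h u) (w u) y * w u ord0 l) / dot (w u) y);
  last by apply/funext => u; rewrite !mxE mulrC.
apply: is_derive_eq (is_derive_quot dn dwy w0) _.
rewrite /base_ddF mul0mx add0r dot0r addr0.
have -> : fiber_dF (h x) (w x) y ord0 l
    = ((y *m h x) ord0 l - fiber_F (h x) (w x) y * w x ord0 l) / dot (w x) y.
  by rewrite !mxE mulrC.
congr (_ / _); ring.
Qed.

(** The fibre derivative of [F u ^+ 2] at [y] has a closed form only where
    [w u] is positive at [y]; [w_near] extends this from [x] to nearby points, as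
    differentiating in [u] requires. *)
Lemma euler_lagrangeE l :
  (\sum_k pd k (fun u => pd l (fun z => F u z ^+ 2) y) x * y ord0 k)
     - pd l (fun u => F u y ^+ 2) x
  = euler_lagrange (h x) (w x) dh dw y l.
Proof.
have U_near : \near x, U x by apply: near_chart.
congr (_ - _).
  apply: eq_bigr => k _; congr (_ * _); apply: pd_val.
  apply: (@near_eq_is_derive _ _ _ (fun u => 2 * (fiber_F (h u) (w u) y
      * fiber_dF (h u) (w u) y ord0 l))).
    apply: filterS2 U_near (w_near wy) => u Uu wu.
    by rewrite FE// pd_fiber_F2 ?hs// mulrA.
  apply: is_derive_eq (is_derive_mul (is_derive_cst (2 : R) _ _)
    (is_derive_mul (is_derive_base_F k) (is_derive_base_dF k l))) _.
  by rewrite /cst mul0r add0r.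
apply: pd_val.
apply: (@near_eq_is_derive _ _ _ (fun u => fiber_F (h u) (w u) y
      * fiber_F (h u) (w u) y)).
  by apply: near_chart => u Uu; rewrite FE// expr2.
apply: is_derive_eq (is_derive_mul (is_derive_base_F l) (is_derive_base_F l)) _.
ring.
Qed.

Lemma sprayE i : spray F i x y =
  (cospray (h x) (w x) (V x) dh dw dV y *m invmx (h x)) ord0 i.
Proof.
set G := _ *m invmx _.
have gG := fiber_tensor_spray (hs Ux) (hpos Ux) (wE Ux) (V1 Ux) dh_tr dw_eq wy.
have gu := fiber_tensor_unit (hs Ux) (hpos Ux) wy.
have -> : G ord0 i = G^T i ord0 by rewrite [RHS]mxE.
rewrite -(mulKmx gu G^T) gG /spray fundamental_tensorE mxE mulr_sumr.
apply: eq_bigr => l _; rewrite euler_lagrangeE [in RHS]mxE.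
by rewrite mulrCA.
Qed.

End Direction.

Let L := lie_mx (h x) (V x) dh dV.

Lemma spray_traceE i j y : 0 < dot (w x) y ->
  spray_trace F i j x y = - n.+1%:R * pd j (pd i (defect (h x) L (w x))) y.
Proof.
move=> wy; have oH := half_space_open (w := w x).
have hsx := hs Ux; have hpx := hpos Ux; have wEx := wE Ux; have V1x := V1 Ux.
have dhs := dh_tr.
pose S r z := (cospray (h x) (w x) (V x) dh dw dV z *m invmx (h x)) ord0 r.
have rS r : rational_on (half_space (w x)) (S r) by exact: rational_spray.
have rphi : rational_on (half_space (w x)) (defect (h x) L (w x)).
  exact: rational_defect.
have comm r : spray3 F i r j r x y = pd j (pd i (pd r (S r))) y.
  transitivity (pd r (pd j (pd i (S r))) y).
    apply: (pd_ext oH _ _ wy) => z1 wz1; apply: (pd_ext oH _ _ wz1) => z2 wz2.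
    apply: (pd_ext oH _ _ wz2) => z3 wz3.
    exact: (sprayE wz3 r).
  rewrite (pd_comm oH r j (rational_pd oH i (rS r)) wy).
  by apply: (pd_ext oH _ _ wy) => z wz; exact: (pd_comm oH r i (rS r) wz).
have rS1 r : rational_on (half_space (w x)) (pd r (S r)) by exact: rational_pd.
rewrite /spray_trace (eq_bigr _ (fun r _ => comm r)).
rewrite -(pd_bigsum oH j (fun r => rational_pd oH i (rS1 r)) wy).
have [q divE] := spray_divergence dw dV hsx hpx wEx V1x dhs.
have pd1 z : 0 < dot (w x) z -> \sum_r pd i (pd r (S r)) z
    = q ord0 i + - n.+1%:R * pd i (defect (h x) L (w x)) z.
  move=> wz; rewrite -(pd_bigsum oH i rS1 wz).
  rewrite (pd_ext oH i (fun z wz => divE z wz) wz) -dot_deltar; apply: pd_val.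
  apply: is_derive_eq (is_derive_sub (is_derive_dotr q z _)
    (is_derive_mul (is_derive_cst (n.+1%:R : R) _ _)
      (rational_is_derive oH i rphi wz))) _.
  by rewrite /cst mul0r add0r mulNr.
rewrite (pd_ext oH j pd1 wy); apply: pd_val.
apply: is_derive_eq (is_derive_add (is_derive_cst (q ord0 i) _ _)
  (is_derive_mul (is_derive_cst (- n.+1%:R : R) _ _)
    (rational_is_derive oH j (rational_pd oH i rphi) wy))) _.
by rewrite /cst mul0r !add0r.
Qed.

Lemma spray_trace_eq0 :
  (forall y, 0 < dot (w x) y -> forall i j, spray_trace F i j x y = 0)
  <-> L = 0.
Proof.
have hsx := hs Ux; have hpx := hpos Ux; have wEx := wE Ux; have V1x := V1 Ux.
have dhs := dh_tr.
have Ls : L^T = L by exact: lie_mx_tr.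
split=> [trace0|L0 y wy i j].
  apply: (defect_hess_eq0 hsx hpx Ls V1x wEx).
    exact: lie_mx_unit.
  move=> z wz i j; have /eqP := trace0 z wz i j.
  by rewrite spray_traceE// mulf_eq0 oppr_eq0 pnatr_eq0 => /eqP.
have phi0 z : defect (h x) L (w x) z = 0.
  rewrite /defect L0 quad_dot mulmx0 dot0l; ring.
rewrite spray_traceE// (_ : defect _ _ _ = fun=> 0); last exact/funext.
rewrite (_ : pd i _ = fun=> 0); last by apply/funext => z; rewrite pd_cst.
by rewrite pd_cst mulr0.
Qed.

End Chart.

(** * Navigation data of a Kropina space *)

Section DerivableInverse.
Variables (R : realType) (X : normedModType R) (x v : X).

Lemma derivable_mul (f g : X -> R) : derivable f x v -> derivable g x v ->
  derivable (fun u => f u * g u) x v.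
Proof. exact: derivableM. Qed.

Lemma derivable_bigsum (I : Type) (r : seq I) (f : I -> X -> R) :
  (forall i, derivable (f i) x v) -> derivable (fun u => \sum_(i <- r) f i u) x v.
Proof.
move=> fd; elim: r => [|i r IH].
  by rewrite (_ : (fun u => _) = cst 0)//; apply/funext => u; rewrite big_nil.
rewrite (_ : (fun u => _) = f i + (fun u => \sum_(i <- r) f i u)).
  exact: derivableD.
by apply/funext => u; rewrite big_cons.
Qed.

Lemma derivable_bigprod (I : Type) (r : seq I) (f : I -> X -> R) :
  (forall i, derivable (f i) x v) -> derivable (fun u => \prod_(i <- r) f i u) x v.
Proof.
move=> fd; elim: r => [|i r IH].
  by rewrite (_ : (fun u => _) = cst 1)//; apply/funext => u; rewrite big_nil.
rewrite (_ : (fun u => _) = f i * (fun u => \prod_(i <- r) f i u)).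
  exact: derivableM.
by apply/funext => u; rewrite big_cons.
Qed.

Lemma derivable_det m (A : X -> 'M[R]_m) :
  (forall i j, derivable (fun u => A u i j) x v) ->
  derivable (fun u => \det (A u)) x v.
Proof.
move=> Ad; rewrite /determinant; apply: derivable_bigsum => s.
apply: (@derivableM _ _ (cst _)); first exact: derivable_cst.
exact: derivable_bigprod.
Qed.

(** Cramer's rule, valid near [x] only: [invmx] is the identity on singular
    matrices. *)
Lemma derivable_invmx m (A : X -> 'M[R]_m) i j :
  (\near x, A x \in unitmx) ->
  (forall i j, derivable (fun u => A u i j) x v) ->
  derivable (fun u => invmx (A u) i j) x v.
Proof.
move=> Au Ad.
apply: (@near_eq_derivable _ _ _ (fun u => (\det (A u))^-1
    * ((-1) ^+ (j + i) * \det (row' j (col' i (A u)))))).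
  apply: filterS Au => u uA; rewrite /invmx uA !mxE //.
have d0 : \det (A x) != 0 by rewrite -unitfE; exact: nbhs_singleton Au.
have [dV _] := is_derive_inv (f := fun u => \det (A u)) d0
  (derivableP (derivable_det Ad)).
apply: (derivable_mul dV (derivable_mul (derivable_cst _ _ _) _)).
apply: derivable_det => k l.
by rewrite (_ : (fun u => _) = fun u => A u (lift j k) (lift i l))//;
  apply/funext => u; rewrite !mxE.
Qed.

End DerivableInverse.

Section NavigationData.
Variables (R : realType) (n : nat) (M : manifold R n).
Variables (a : riemannian_metric M) (b : one_form M).
Hypothesis hb : nowhere_vanishing b.
Variables (c : chart_index M).

Let h := nav_metric (a c) (b c).
Let w := nav_covector (a c) (b c).
Let V := nav_field (a c) (b c).
Let e u := expR (kappa (a c) (b c) u).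

Lemma nav_metric_sym u : cod (atlas c) u -> (h u)^T = h u.
Proof. by move=> Uu; rewrite linearZ/= Defs.metric_sym. Qed.

Lemma nav_metric_posdef u : cod (atlas c) u ->
  forall y, y != 0 -> 0 < quad (h u) y.
Proof.
move=> Uu y y0; rewrite quadZ mulr_gt0 ?expR_gt0//.
exact: metric_posdef.
Qed.

Lemma nav_metric_inv u : cod (atlas c) u ->
  invmx (h u) = (e u)^-1 *: invmx (a c u).
Proof.
move=> Uu; rewrite /h /nav_metric invmxZ// unitmxZ ?metric_unit//.
by rewrite unitfE gt_eqF// expR_gt0.
Qed.

Lemma nav_fieldE u : cod (atlas c) u -> V u = w u *m invmx (h u).
Proof.
move=> Uu; apply/rowP => i; rewrite !mxE; apply: eq_bigr => j _.
rewrite mulrC; congr (_ * _); apply: sym_mxE.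
by rewrite trmx_inv nav_metric_sym.
Qed.

Lemma nav_covectorE u : cod (atlas c) u -> w u = V u *m h u.
Proof.
move=> Uu; rewrite nav_fieldE// mulmxKV//.
exact: h_unit (nav_metric_posdef Uu).
Qed.

Lemma nav_field_unit u : cod (atlas c) u -> dot (w u) (V u) = 1.
Proof.
move=> Uu; rewrite nav_fieldE// dotC -quad_dot nav_metric_inv// quadZ.
rewrite quad_dot /w /nav_covector -scalemxAl dotZl dotZr -quad_dot.
have := kappaE a hb Uu; rewrite /sqnorm -/(e u).
have e0 : e u != 0 by rewrite gt_eqF// expR_gt0.
move=> E; transitivity (4^-1 * (e u * quad (invmx (a c u)) (b c u))).
  by field.
by rewrite E mulVf.
Qed.

Lemma kropina_nav u : cod (atlas c) u ->
  kropina (a c) (b c) u = fiber_F (h u) (w u).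
Proof.
move=> Uu; apply/funext => z; rewrite /kropina /alpha sqr_sqrtr; last first.
  have [->|z0] := eqVneq z 0; first by rewrite quad_dot mul0mx dot0l.
  by apply/ltW/metric_posdef.
have e0 : e u != 0 by rewrite gt_eqF// expR_gt0.
rewrite /fiber_F quadZ dotZl -/(e u) -/(dot (b c u) z).
(* no condition on dot (w u) z: when it vanishes both sides are 0, as 0^-1 = 0 *)
by rewrite mulrA (mulrC 2) divfK// invfM mulrACA divff// mul1r.
Qed.

Lemma nav_unitE u : cod (atlas c) u -> quad (h u) (V u) = 1.
Proof. by move=> Uu; rewrite quad_dot -nav_covectorE// nav_field_unit. Qed.

Lemma beta_nav u y : (0 < beta (b c) u y) = (0 < dot (w u) y).
Proof. by rewrite dotZl pmulr_rgt0// divr_gt0 ?expR_gt0. Qed.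

Section Derivatives.
Variable x : 'rV[R]_n.
Hypothesis Ux : cod (atlas c) x.

Let near_cod (P : 'rV[R]_n -> Prop) :
  (forall u, cod (atlas c) u -> P u) -> \near x, P x.
Proof. by move=> cP; apply: near_on Ux cP; exact: cod_open. Qed.

Let derivable_form k i :
  derivable (fun u => b c u ord0 i) x (delta_mx ord0 k).
Proof. by have [_ /(_ k) [/(_ x Ux)]] := form_smooth b c i 1. Qed.

Let derivable_metric k i j :
  derivable (fun u => a c u i j) x (delta_mx ord0 k).
Proof. by have [_ /(_ k) [/(_ x Ux)]] := metric_smooth a c i j 1. Qed.

Let derivable_conformal k : derivable e x (delta_mx ord0 k).
Proof.
have s0 : sqnorm (a c) (b c) x != 0 by rewrite gt_eqF// sqnorm_gt0.
apply: (@near_eq_derivable _ _ _ (fun u => 4 * (sqnorm (a c) (b c) u)^-1)).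
  apply: near_cod => u Uu; rewrite -(kappaE a hb Uu) mulfK//.
  by rewrite gt_eqF// sqnorm_gt0.
have sd : derivable (sqnorm (a c) (b c)) x (delta_mx ord0 k).
  apply: derivable_bigsum => i; apply: derivable_bigsum => j.
  have inv_d : derivable (fun u => invmx (a c u) i j) x (delta_mx ord0 k).
    apply: derivable_invmx => //.
    by apply: near_cod => u; exact: metric_unit.
  exact: derivable_mul (derivable_mul inv_d (@derivable_form k i))
    (@derivable_form k j).
have [sV _] := is_derive_inv s0 (derivableP sd).
exact: derivable_mul (derivable_cst _ _ _) sV.
Qed.

Let derivable_nav_metric k i j :
  derivable (fun u => h u i j) x (delta_mx ord0 k).
Proof.
rewrite (_ : (fun u => _) = e * (fun u => a c u i j)).
  exact: derivableM.
by apply/funext => u; rewrite mxE.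
Qed.

Let derivable_nav_covector k i :
  derivable (fun u => w u ord0 i) x (delta_mx ord0 k).
Proof.
rewrite (_ : (fun u => _) = e * (cst 2^-1 * (fun u => b c u ord0 i))).
  by apply: derivableM => //; apply: derivableM => //; exact: derivable_cst.
by apply/funext => u; rewrite mxE -mulrA.
Qed.

Let derivable_nav_field k i :
  derivable (fun u => V u ord0 i) x (delta_mx ord0 k).
Proof.
rewrite (_ : (fun u => _) = fun u => \sum_j invmx (h u) i j * w u ord0 j).
  apply: derivable_bigsum => j.
  apply: derivable_mul (@derivable_nav_covector k j).
  apply: derivable_invmx => //.
  by apply: near_cod => u Uu; exact: h_unit (nav_metric_posdef Uu).
by apply/funext => u; rewrite mxE.
Qed.

Let beta_near y : 0 < dot (w x) y -> \near x, 0 < dot (w x) y.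
Proof.
rewrite -beta_nav => by0.
have bc : {for x, continuous (fun u => dot (b c u) y)}.
  apply: cvg_dot => i; last exact: cst_continuous.
  by have [/(_ x Ux)] := form_smooth b c i 0.
have b_near : \near x, 0 < dot (b c x) y by exact: cvgr_gt bc _ by0.
by apply: filterS b_near => u; rewrite -beta_nav.
Qed.

Lemma spray_trace_lie :
  (forall y, 0 < beta (b c) x y -> forall i j,
     spray_trace (kropina (a c) (b c)) i j x y = 0) <->
  (forall i j, lie_metric h V i j x = 0).
Proof.
pose dh k : 'M[R]_n := \matrix_(i, j) pd k (fun u => h u i j) x.
pose dw k : 'rV[R]_n := \row_i pd k (fun u => w u ord0 i) x.
pose dV k : 'rV[R]_n := \row_i pd k (fun u => V u ord0 i) x.
have hd k : mx_derive x (delta_mx ord0 k) h (dh k).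
  by move=> i j; rewrite [dh k i j]mxE; exact: derivableP (@derivable_nav_metric k i j).
have wd k : mx_derive x (delta_mx ord0 k) w (dw k).
  by move=> i j; rewrite (ord1 i) [dw k _ _]mxE; exact: derivableP (@derivable_nav_covector k j).
have Vd k : mx_derive x (delta_mx ord0 k) V (dV k).
  by move=> i j; rewrite (ord1 i) [dV k _ _]mxE; exact: derivableP (@derivable_nav_field k j).
have LE i j : lie_metric h V i j x = lie_mx (h x) (V x) dh dV i j.
  by rewrite mxE; apply: eq_bigr => k _; rewrite !mxE.
have := spray_trace_eq0 (@cod_open _ _ _ (atlas c)) Ux kropina_nav
  nav_metric_sym nav_metric_posdef nav_covectorE nav_field_unit hd wd Vd beta_near.
move=> [tL Lt]; split=> [trace0 i j|L0 y].
  rewrite LE tL ?mxE// => y wy; apply: trace0; by rewrite beta_nav.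
rewrite beta_nav; apply: Lt; apply/matrixP => i j.
by rewrite -LE L0 mxE.
Qed.

End Derivatives.
End NavigationData.

Theorem theorem3p2 (R : realType) (n : nat) (M : manifold R n)
    (a : riemannian_metric M) (b : one_form M) (hb : nowhere_vanishing b) :
  (weakly_berwald a b <-> strong_kropina a b) /\
  (weakly_berwald a b <-> nav_killing a b).
Proof.
have killing : weakly_berwald a b <-> nav_killing a b.
  split=> [wb c x cx|kl c x y cx y0].
    have [trace_lie _] := spray_trace_lie a hb cx.
    by apply: trace_lie => y; exact: wb.
  have [_ lie_trace] := spray_trace_lie a hb cx.
  by apply: lie_trace y0; exact: kl.
have unit : nav_unit a b by move=> c x cx; exact: nav_unitE.
split=> //; split=> [/killing|[_ /killing]]//.
Qed.
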